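(* Every GOSP (generalised oriented site percolation) has a sharp transition. That is, let $X\subset R$ and, for $p\in[0,1]$, let $\upsilon_p=p\,\delta_{\mathcal U_X}+(1-p)\,\delta_{\varnothing}$, where $\mathcal U_X=\{Y\subset R:Y\cap X\neq\varnothing\}$ and $\delta_\varnothing$ is the Dirac mass at the empty up-family. Let $p_{\mathrm c}=\inf\{p\in[0,1]:\delta_{\mathbf 0}\text{ is not the unique invariant measure of }\upsilon_p\}$, with $\inf\varnothing=1$. Then for every $p\in[0,p_{\mathrm c})$ there exist $c,C>0$ such that for all integers $t>0$ and all finite $A\subset\mathbb Z^d\times([-r,0)\cap\mathbb Z)$, $$\mathbb P_{\upsilon_p}\left(\eta_0^{\mathbf 1}(t)\neq0\right)\le Ce^{-ct},\qquad \mathbb P_{\upsilon_p}\left(\eta^A(t)\neq\mathbf 0\right)\le C|A|e^{-ct}.$$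
   Context: Fix an integer $d\ge 1$ and a range $r\in[1,\infty)$. Set $R=([-r,r]^d\times[-r,0))\cap\mathbb Z^{d+1}$. For any set $X$, elements of $\{0,1\}^X$ are identified with subsets of $X$ (the set of points with value $1$). A configuration is an element of $\Omega=\{0,1\}^{\mathbb Z^d\times([-r,0)\cap\mathbb Z)}$. Let $\Omega_R=\{0,1\}^R$, identified with the power set of $R$ and ordered by inclusion. An up-family is a collection $\mathcal U\subset\Omega_R$ such that $X\in\mathcal U$ and $X\subset Y\subset R$ imply $Y\in\mathcal U$. Let $\mathscr U$ be the (finite) system of all up-families (including the empty one). An attractive PCA (probabilistic cellular automaton) is a probability measure $\upsilon$ on $\mathscr U$. Given $\upsilon$, let $(\mathcal U_{x,t})_{(x,t)\in\mathbb Z^d\times\mathbb Z}$ be i.i.d. up-families with law $\upsilon$, whose joint law is denoted $\mathbb P_\upsilon$. Given $\omega\in\Omega$, the process $\eta^\omega$ started from $\omega$ has $\eta^\omega_x(s)=\omega_{(x,s)}$ for $s\in[-r,0)\cap\mathbb Z$, and, inductively for integers $t\ge0$ and $x\in\mathbb Z^d$, $\eta^\omega_x(t)=1$ if $\{(y,s)\in R:\eta^\omega_{x+y}(t+s)=1\}\in\mathcal U_{x,t}$ and $\eta^\omega_x(t)=0$ otherwise. We write $\eta^\omega(t)=(\eta^\omega_x(t))_{x\in\mathbb Z^d}$. The symbols $\mathbf 0$ and $\mathbf 1$ denote the all-$0$ and all-$1$ configurations (on the relevant index set). An invariant measure is a probability measure on $\Omega$ such that, if the initial configuration has this law and is independent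 of the field, then for all $t\ge0$ the configuration $(\eta_x(t+s))_{x\in\mathbb Z^d,\,s\in[-r,0)\cap\mathbb Z}$ has the same law. *)

(* Defs.v *)
From HB Require Import structures.
From mathcomp Require Import all_boot all_order all_algebra finmap.
From mathcomp Require Import all_classical all_reals all_analysis.

Set Implicit Arguments.
Unset Strict Implicit.
Unset Printing Implicit Defensive.
Import Order.TTheory GRing.Theory Num.Theory.
Local Open Scope classical_set_scope.
Local Open Scope ring_scope.

(* The space of functions I -> X with the product sigma-algebra, generated by
   the one-coordinate cylinders. *)
Definition cylinders (I : Type) (disp : measure_display)
    (X : measurableType disp) : set (set (I -> X)) :=
  [set C | exists (i : I) (E : set X), measurable E /\ C = [set f | E (f i)]].

Definition prodspace (I : Type) (disp : measure_display)
    (X : measurableType disp) := g_sigma_algebraType (@cylinders I disp X).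

(* Space-time points Z^d x Z. *)
Definition site (d : nat) : Type := ('rV[int]_d * int)%type.

Section Model.
Context {K : realType} (d : nat) (r : K).

Definition range_box : set (site d) :=
  [set v : site d | (forall i, - r <= (v.1 0 i)%:~R <= r) /\
                    (- r <= v.2%:~R) && (v.2 < 0)].

(* Z^d x ([-r,0) /\ Z) *)
Definition slab : Type := {v : site d | (- r <= v.2%:~R) && (v.2 < 0)}.

HB.instance Definition _ := Choice.on slab.

Definition config := prodspace slab bool.

Definition config0 : config := fun=> false.
Definition config1 : config := fun=> true.
Definition config_of (A : {fset slab}) : config := fun v => v \in A.

(* Up-families on R, as sets of subsets of R. *)
Record upfamily : Type := UpFamily {
  upset :> set (set (site d));
  upset_sub : forall Y, upset Y -> Y `<=` range_box;
  upset_up : forall Y Z, upset Y -> Y `<=` Z -> Z `<=` range_box -> upset Z }.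

Definition up_empty : upfamily.
Proof. by exists set0. Defined.

Definition up_meets (X : set (site d)) : upfamily.
Proof.
exists [set Y | Y `<=` range_box /\ Y `&` X !=set0].
- by move=> Y [].
- move=> Y Z [_ [v [Yv Xv]]] YZ ZR; split=> //.
  by exists v; split=> //; exact: YZ.
Defined.

(* There are finitely many up-families, whence the discrete sigma-algebra. *)
HB.instance Definition _ := gen_eqMixin upfamily.
HB.instance Definition _ := gen_choiceMixin upfamily.
HB.instance Definition _ := isPointed.Build upfamily up_empty.
HB.instance Definition _ := @isMeasurable.Build default_measure_display
  upfamily discrete_measurable discrete_measurable0
  discrete_measurableC discrete_measurableU.

Definition attractive_pca := probability upfamily K.

Definition field := prodspace (site d) upfamily.

(* P is the law P_u of an i.i.d. field with common law u: the coordinates of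
   the canonical field are independent (over every finite set of sites) and
   each has law u. *)
Definition iid_law (u : attractive_pca) (P : probability field K) : Prop :=
  forall (J : {fset site d}) (E : site d -> set upfamily),
    P [set U | forall v, v \in J -> E v (U v)] = (\prod_(v <- J) u (E v))%E.

(* [traj U w n] is the trajectory started from w and driven by U, at all times
   < n (its value is irrelevant at times >= n or < -r). *)
Fixpoint traj (U : field) (w : config) (n : nat) (v : site d) : bool :=
  match n with
  | 0%N => if insub v is Some v' then w v' else false
  | m.+1 => if v.2 == m%:Z
            then `[< upset (U v) [set z | range_box z /\ traj U w m (v + z)] >]
            else traj U w m v
  end.

(* eta U w (x, t) is the state of x at time t >= -r. *)
Definition eta (U : field) (w : config) (v : site d) : bool :=
  traj U w `|v.2|%N.+1 v.

Definition eta_at (U : field) (w : config) (t : nat) : 'rV[int]_d -> bool :=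
  fun x => eta U w (x, t%:Z).

Definition eta_window (U : field) (w : config) (t : nat) : config :=
  fun v => eta U w ((val v).1, t%:Z + (val v).2).

Lemma traj_stable U w (v : site d) (n : nat) :
  v.2 < n%:Z -> traj U w n v = eta U w v.
Proof.
rewrite /eta; elim: n => [|n IHn] vn.
  have h m : traj U w m v = traj U w 0 v.
    elim: m => //= m <-; case: eqP => // e; move: vn.
    by rewrite e ltNge.
  by rewrite [RHS]h.
have [e|ne] := eqVneq v.2 n%:Z; first by rewrite e absz_nat.
rewrite -IHn /= ?(negPf ne)//.
by rewrite lt_neqAle ne /= -ltzD1 -PoszD addn1.
Qed.

Lemma eta_init U w (v : slab) : eta U w (val v) = w v.
Proof.
have v0 : (val v).2 < 0 by have /andP[_] := valP v.
by rewrite -(@traj_stable _ _ _ 0)//= valK.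
Qed.

Lemma eta_step U w (x : 'rV[int]_d) (t : nat) :
  eta U w (x, t%:Z) =
  `[< upset (U (x, t%:Z))
      [set z | range_box z /\ eta U w (x + z.1, t%:Z + z.2)] >].
Proof.
rewrite /eta /= eqxx; congr (`[< _ _ >]); apply/seteqP; split=> z [Rz].
- rewrite traj_stable//=.
  by case: Rz => _ /andP[_ z0]; rewrite gtrDl.
- move=> h; split=> //; rewrite traj_stable//=.
  by case: Rz => _ /andP[_ z0]; rewrite gtrDl.
Qed.

(* mu \x P is the joint law of an initial configuration with law mu and an
   independent field with law P. *)
Definition invariant (u : attractive_pca) (mu : probability config K) : Prop :=
  forall P : probability field K, iid_law u P ->
  forall (t : nat) (B : set config), measurable B ->
    (mu \x P)%E [set z | B (eta_window z.2 z.1 t)] = mu B.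

(* Measures are compared on measurable sets only. *)
Definition unique_invariant0 (u : attractive_pca) : Prop :=
  invariant u (dirac config0) /\
  forall mu : probability config K, invariant u mu ->
    forall B : set config, measurable B -> mu B = dirac config0 B.

Section Gosp.
Variables (X : set (site d)) (p : {i01 K}).

Definition gosp : set upfamily -> \bar K :=
  measure_add (mscale p%:num%:nng (dirac (up_meets X)))
              (mscale (1 - p%:num)%:nng (dirac up_empty)).

HB.instance Definition _ := Measure.on gosp.

Let gosp_setT : gosp setT = 1%E.
Proof.
rewrite /gosp measure_addE /= /mscale /= !diracT !mule1 -EFinD.
by rewrite addrC subrK.
Qed.

HB.instance Definition _ := @Measure_isProbability.Build _ _ K gosp gosp_setT.

End Gosp.

Definition gosp_bad (X : set (site d)) : set K :=
  [set q | exists p : {i01 K}, p%:num = q /\ ~ unique_invariant0 (gosp X p)].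

(* The library's inf set0 is 0. *)
Definition p_crit (X : set (site d)) : K :=
  if `[< gosp_bad X = set0 >] then 1 else inf (gosp_bad X).

End Model.

Arguments range_box {K d} r.
Arguments config0 {K d} r.
Arguments config1 {K d} r.
Arguments gosp {K d} r X p.
Arguments gosp_bad {K d} r X.
Arguments p_crit {K d} r X.

(* Main.v *)
Require Import Defs.
From HB Require Import structures.
From mathcomp Require Import all_boot all_order all_algebra finmap.
From mathcomp Require Import all_classical all_reals all_analysis.
From mathcomp Require Import polyrcf zify ring lra.

(** [eta^1_(x,t) = 1] means that an open path, with steps in [X], leads from
[(x,t)] down to negative times, and the proof is that of Duminil-Copin and
Tassion. For a finite set [S] of sites containing the starting point [o], let
[phi_q(S)] be the expected number, at density [q], of steps out of [S] that
start at a site reached from [o] by an open path inside [S].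

If [phi_p(S) >= 1] for all [S], then Russo's formula, applied conditionally on
the random set of sites that are not connected to negative times (all the steps
out of which lead to pivotal sites), bounds below the derivative of
[q |-> P_q(eta^1_0(n) = 1)] on [[p,1]], uniformly in [n]. This contradicts the
uniqueness of the invariant measure at some [p'] in [(p, p_c)]: the indicator of
the sites with an infinite open path into the past is invariant in law, so that
uniqueness gives [P_p'(eta^1_0(n) = 1) --> 0].

Hence [phi_p(S) < 1] for some [S]; cutting a path at its last exit from the open
cluster of [o] in [S] gives [theta_n <= phi_p(S) max_(n-k <= m < n) theta_m], where
[k] is the depth of [S], hence exponential decay of
[theta_n = P_p(eta^1_0(n) = 1)]. The bound for [eta^A] follows by summing over the
polynomially many sites at time [t] in the light cones of the points of [A]. *)

Set Implicit Arguments.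
Unset Strict Implicit.
Unset Printing Implicit Defensive.
Import Order.TTheory GRing.Theory Num.Theory.
Local Open Scope ring_scope.

(** * Bernoulli product measures on finite sets *)

Lemma ler_sum_inj (K : numDomainType) (I J : finType) (A : pred I) (B : pred J)
    (h : I -> J) (G : J -> K) :
  {in A &, injective h} -> (forall i, A i -> B (h i)) -> (forall j, 0 <= G j) ->
  \sum_(i | A i) G (h i) <= \sum_(j | B j) G j.
Proof.
move=> injh AB G0; rewrite -(big_imset _ injh) /=.
rewrite [leRHS]big_mkcond [leLHS]big_mkcond /=; apply: ler_sum => j _.
case: ifP => [/imsetP[i Ai ->]|_]; first by rewrite AB.
by case: ifP.
Qed.

Section BernoulliProduct.
Variable V : finType.
Implicit Types (s t : {ffun V -> bool}) (v : V).

Definition weight (R : comNzRingType) (q : R) s : R :=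
  \prod_v (if s v then q else 1 - q).

Definition expect (R : comNzRingType) (q : R) (f : {ffun V -> bool} -> R) : R :=
  \sum_s weight q s * f s.

Definition prob (R : comNzRingType) (q : R) (A : pred {ffun V -> bool}) : R :=
  expect q (fun s => (A s)%:R).

Definition update s v (c : bool) : {ffun V -> bool} :=
  [ffun u => if u == v then c else s u].

Definition influence (R : comNzRingType) (f : {ffun V -> bool} -> R) v s : R :=
  f (update s v true) - f (update s v false).

Lemma sum_weight (R : comNzRingType) (q : R) : \sum_s weight q s = 1.
Proof.
rewrite /weight -(bigA_distr_bigA (fun _ c => if c then q else 1 - q)).
by rewrite big1// => v _; rewrite big_bool /= addrC subrK.
Qed.

Lemma expect_sum (R : comNzRingType) (q : R) (I : finType) (Q : pred I) F :
  expect q (fun s => \sum_(i | Q i) F i s) = \sum_(i | Q i) expect q (F i).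
Proof.
rewrite /expect exchange_big /=.
by apply: eq_bigr => s _; rewrite big_distrr.
Qed.

Lemma expect1 (R : comNzRingType) (q : R) : expect q (fun=> 1) = 1.
Proof. by rewrite /expect -[RHS](sum_weight q); apply: eq_bigr => s _;
  rewrite mulr1. Qed.
Lemma expectM_indep (R : comNzRingType) (q : R) (Z : {set V}) f g :
  (forall s t, {in Z, s =1 t} -> f s = f t) ->
  (forall s t, {in ~: Z, s =1 t} -> g s = g t) ->
  expect q (fun s => f s * g s) = expect q f * expect q g.
Proof.
move=> fZ gZ.
(* Swapping two independent copies off [Z] preserves the product weight. *)
pose mix s t : {ffun V -> bool} := [ffun v => if v \in Z then s v else t v].
rewrite /expect big_distrlr /= pair_big /=.
have mixK : involutive (fun st : {ffun V -> bool} * {ffun V -> bool} =>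
    (mix st.1 st.2, mix st.2 st.1)).
  by case=> s t /=; congr pair; apply/ffunP => v; rewrite !ffunE;
    case: (v \in Z).
rewrite (reindex_inj (inv_inj mixK)) /=.
have mixW s t : weight q (mix s t) * weight q (mix t s) = weight q s * weight q
    t.
  rewrite /weight -!big_split /=; apply: eq_bigr => v _; rewrite !ffunE.
  by case: (v \in Z) => //; rewrite mulrC.
rewrite (eq_bigr (fun st => weight q st.1 * (f st.1 * g st.1) * weight q st.2)).
  rewrite -(pair_big xpredT xpredT
    (fun s t => weight q s * (f s * g s) * weight q t)) /=.
  by apply: eq_bigr => s _; rewrite -big_distrr /= sum_weight mulr1.
move=> [s t] _ /=.
rewrite (fZ _ s); last by move=> v vZ; rewrite ffunE vZ.
rewrite (gZ _ s); last by move=> v; rewrite inE ffunE => /negPf->.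
by rewrite mulrACA mixW mulrAC.
Qed.

(** Pairing the configurations that differ only at [v] is what turns a derivative in the density
    into a discrete derivative of the observable. *)
Lemma sum_update (R : comNzRingType) v (h : {ffun V -> bool} -> R) :
  \sum_s h s = \sum_(s : {ffun V -> bool} | s v) (h s + h (update s v false)).
Proof.
rewrite big_split /= (bigID (fun s : {ffun V -> bool} => s v)) /=;
  congr (_ + _).
rewrite (reindex_onto (fun s => update s v false) (fun s =>
  update s v true)) /=; last first.
  move=> s /negPf sv; apply/ffunP => u; rewrite !ffunE.
  by have [->|_] := eqVneq u v.
apply: eq_bigl => s; rewrite ffunE eqxx /=.
apply/eqP/idP => [<-|sv]; first by rewrite ffunE eqxx.
by apply/ffunP => u; rewrite !ffunE; have [->|_] := eqVneq u v.
Qed.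

(** * Russo's formula *)

Section Russo.
Variable K : comNzRingType.
Implicit Types f : {ffun V -> bool} -> K.

(** The expectation as a polynomial in the density: differentiation becomes formal, and over a real
    closed field the mean value theorem for polynomials applies. *)
Definition expect_poly f : {poly K} := \sum_s f s *: weight 'X s.

Lemma horner_expect_poly f q : (expect_poly f).[q] = expect q f.
Proof.
rewrite /expect_poly horner_sum; apply: eq_bigr => s _.
rewrite hornerZ mulrC; congr (_ * _).
rewrite /weight horner_prod; apply: eq_bigr => v _.
by case: ifP; rewrite !hornerE.
Qed.

Lemma deriv_prod (I : finType) (F : I -> {poly K}) :
  (\prod_i F i)^`() = \sum_i (F i)^`() * \prod_(j | j != i) F j.
Proof.
suff H (r : seq I) : uniq r -> (\prod_(i <- r) F i)^`() =
    \sum_(i <- r) (F i)^`() * \prod_(j <- r | j != i) F j.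
  by rewrite H// index_enum_uniq.
elim: r => [|i r IH] /=; first by rewrite !big_nil derivC.
move=> /andP[ir /IH{}IH]; rewrite !big_cons eqxx /= derivM IH;
  congr (_ * _ + _).
  rewrite [RHS]big_seq_cond [LHS]big_seq; apply: eq_bigl => j.
  by case: eqP => [->|]; rewrite ?(negPf ir)// andbT.
rewrite big_distrr /= [LHS]big_seq [RHS]big_seq; apply: eq_bigr => j jr.
rewrite big_cons ifT; first by rewrite mulrCA.
by apply: contraNneq ir => ->.
Qed.

(** Differentiating the factor at [v] yields a sign; adding the terms of two configurations that
    differ only at [v] turns the signed sum into the influence of [v]. *)
Lemma russo f q :
  (expect_poly f)^`().[q] = \sum_v expect q (influence f v).
Proof.
rewrite /expect_poly raddf_sum /= horner_sum.
pose W v (s : {ffun V -> bool}) : K :=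
  \prod_(u | u != v) (if s u then q else 1 - q).
pose sg (c : bool) : K := if c then 1 else -1.
transitivity (\sum_s \sum_v f s * (sg (s v) * W v s)).
  apply: eq_bigr => s _; rewrite derivZ hornerZ /weight deriv_prod horner_sum.
  rewrite big_distrr /=; apply: eq_bigr => v _; rewrite hornerM horner_prod.
  congr (_ * (_ * _)).
    by rewrite /sg; case: (s v); rewrite !poly.derivE ?sub0r !hornerE.
  by apply: eq_bigr => u _; case: (s u); rewrite !hornerE.
rewrite exchange_big /=; apply: eq_bigr => v _; rewrite /expect.
have W0 s : W v (update s v false) = W v s.
  by apply: eq_bigr => u /negPf uv; rewrite ffunE uv.
rewrite (sum_update v) [RHS](sum_update v); apply: eq_bigr => s sv.
have wE s' : weight q s' = (if s' v then q else 1 - q) * W v s'.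
  by rewrite /weight (bigD1 v).
have s1 : update s v true = s.
  by apply/ffunP => u; rewrite ffunE; have [->|_] := eqVneq u v.
have s01 c : update (update s v false) v c = update s v c.
  by apply/ffunP => u; rewrite !ffunE; have [_|_] := eqVneq u v.
rewrite !wE /influence !s01 s1 W0 ffunE eqxx sv /sg.
rewrite -mulrDl; ring.
Qed.
End Russo.

Section Order.
Variables (K : realDomainType) (q : K).
Hypothesis q01 : 0 <= q <= 1.
Implicit Types f g : {ffun V -> bool} -> K.

Lemma weight_ge0 s : 0 <= weight q s.
Proof.
case/andP: q01 => q0 q1; apply: prodr_ge0 => v _.
by case: (s v) => //; rewrite subr_ge0.
Qed.

Lemma ler_expect f g : (forall s, f s <= g s) -> expect q f <= expect q g.
Proof. by move=> fg; apply: ler_sum => s _; rewrite ler_wpM2l ?weight_ge0. Qed.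

Lemma expect_ge0 f : (forall s, 0 <= f s) -> 0 <= expect q f.
Proof. by move=> f0; apply: sumr_ge0 => s _; rewrite mulr_ge0 ?weight_ge0. Qed.

Lemma ler_prob (A B : pred {ffun V -> bool}) :
  (forall s, A s -> B s) -> prob q A <= prob q B.
Proof.
by move=> AB; apply: ler_expect => s; rewrite ler_nat;
  case: (A s) (AB s) => // ->.
Qed.

Lemma prob_ge0 A : 0 <= prob q A.
Proof. by apply: expect_ge0 => s; rewrite ler0n. Qed.

End Order.

Definition increasing (A : pred {ffun V -> bool}) :=
  forall s t, (forall v, s v -> t v) -> A s -> A t.

(** By the mean value theorem the difference is a derivative times [q' - q], and by Russo's formula
    that derivative is a sum of nonnegative influences. *)
Lemma prob_increasing (K : rcfType) (A : pred {ffun V -> bool}) (q q' : K) :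
  increasing A -> 0 <= q -> q <= q' -> q' <= 1 -> prob q A <= prob q' A.
Proof.
move=> incA q0; rewrite le_eqVlt => /predU1P[->//|qq'] q'1.
rewrite -subr_ge0 /prob -!horner_expect_poly.
have [c /andP[qc cq'] ->] := poly_mvt (expect_poly (fun s => (A s)%:R)) qq'.
rewrite mulr_ge0 ?subr_ge0 ?(ltW qq')// russo.
apply: sumr_ge0 => v _; apply: expect_ge0.
  by move: qc cq'; rewrite /= !bnd_simp => qc cq'; lra.
move=> s; rewrite subr_ge0 ler_nat.
case: (A (update s v false)) (incA (update s v false) (update s v true)) =>
  // -> // u.
by rewrite !ffunE; case: eqP.
Qed.
End BernoulliProduct.

(** * Directed site percolation on a finite graph *)

Section Graph.
Variables (V : finType) (e : rel V) (b : pred V).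
Implicit Types (s t : {ffun V -> bool}) (S T : {set V}).

(* The state of the starting point is disregarded, so that the event
   [exits s = T] depends only on the restriction of [s] to [T]. *)
Definition exits s : {set V} :=
  [set x | [exists y, b y && connect [rel u v | e u v && s v] x y]].

(** On a finite window this is the event that the process started from [config1] is in state 1 at
    [o]; see [eta_crosses]. *)
Definition crosses o s := s o && (o \in exits s).

Definition reach S o u s :=
  [&& s o, o \in S & connect [rel x y | [&& e x y, s y & y \in S]] o u].

(** The functional [phi_q(S)] of Duminil-Copin and Tassion. The end point [v] of a step contributes
    no factor [q]: its state is accounted for by [crosses v], or by its being pivotal. *)
Definition outflow (R : comNzRingType) (q : R) S o : R :=
  \sum_(u in S) \sum_(v | (v \notin S) && e u v) prob q (reach S o u).

Lemma exits_exit s x : b x -> x \in exits s.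
Proof. by move=> bx; rewrite inE; apply/existsP; exists x;
  rewrite bx connect0. Qed.

Lemma exits_arc s x y : e x y -> s y -> y \in exits s -> x \in exits s.
Proof.
move=> exy sy; rewrite !inE => /existsP[z /andP[bz yz]].
apply/existsP; exists z; rewrite bz /=; apply: connect_trans yz.
by apply: connect1; rewrite /= exy.
Qed.

(** Induction along an open path, from its exit back to its start; [reach_ind] goes in the other
    direction. *)
Lemma exits_ind s (Q : V -> Prop) :
  (forall x, b x -> Q x) ->
  (forall x y, e x y -> s y -> y \in exits s -> Q y -> Q x) ->
  forall x, x \in exits s -> Q x.
Proof.
move=> Qb Qe x; rewrite inE => /existsP[y /andP[b_y /connectP[p]]].
elim: p x => [x _ /= <-|z p IH x /= /andP[/andP[exz sz] zp] yE];
  first exact: Qb.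
apply: (Qe _ z) => //; last exact: IH.
by rewrite inE; apply/existsP; exists y; rewrite b_y; apply/connectP; exists p.
Qed.

Lemma exits_incr s t : (forall v, s v -> t v) -> exits s \subset exits t.
Proof.
move=> st; apply/fintype.subsetP; apply: exits_ind => [x|x y exy sy _];
  first exact: exits_exit.
exact: exits_arc exy (st _ sy).
Qed.

(** A site joins the set through an arc whose head already lies in it and is open, so the
    exploration from the exits consults no state outside the set that it finds. *)
Lemma exits_local s t : {in exits s, s =1 t} -> exits t = exits s.
Proof.
move=> st; apply/eqP; rewrite finset.eqEsubset; apply/andP; split;
  apply/fintype.subsetP.
  apply: exits_ind => [x|x y exy ty _ ys]; first exact: exits_exit.
  by apply: (exits_arc exy) => //; rewrite st.
apply: exits_ind => [x|x y exy sy ys yt]; first exact: exits_exit.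
by apply: (exits_arc exy) => //; rewrite -st.
Qed.

Lemma reach_ind S o u s (Q : V -> Prop) : (s o -> o \in S -> Q o) ->
  (forall x y, reach S o x s -> Q x -> e x y -> s y -> y \in S -> Q y) ->
  reach S o u s -> Q u.
Proof.
move=> Q0 QS /and3P[so oS /connectP[p]].
have H x : Q x -> reach S o x s ->
    path [rel x y | [&& e x y, s y & y \in S]] x p -> Q (last x p).
  elim: p x => [//|z p IH] x Qx ox /= /andP[/and3P[exz sz zS] zp].
  apply: (IH z) zp; first exact: (QS x).
  case/and3P: ox => _ _ ox; rewrite /reach so oS; apply: connect_trans ox _.
  by apply: connect1; rewrite /= exz sz.
move=> op ->; apply: H op; first exact: Q0.
by rewrite /reach so oS connect0.
Qed.

Lemma reach_refl S o s : s o -> o \in S -> reach S o o s.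
Proof. by rewrite /reach => -> ->; rewrite connect0. Qed.

Lemma reach_arc S o x y s :
  reach S o x s -> e x y -> s y -> y \in S -> reach S o y s.
Proof.
move=> /and3P[so oS ox] exy sy yS; rewrite /reach so oS;
  apply: connect_trans ox _.
by apply: connect1; rewrite /= exy sy.
Qed.

Lemma reach_sub S o u s : reach S o u s -> u \in S.
Proof. exact: (@reach_ind _ _ _ _ (fun u => u \in S)). Qed.

Lemma reach_incr S o u : increasing (reach S o u).
Proof.
move=> s t st; apply: (@reach_ind _ _ _ _ (fun u => reach S o u t)) =>
  [so|x y _ ox exy sy]; first exact: reach_refl (st _ so).
by apply: (reach_arc ox exy); exact: st.
Qed.

Lemma reach_local S o u s t : {in S, s =1 t} -> reach S o u s = reach S o u t.
Proof.
move=> st; rewrite /reach; case oS : (o \in S); last by rewrite !andbF.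
rewrite (st _ oS); congr [&& _, _ & _]; apply: eq_connect => x y /=.
by case yS: (y \in S); rewrite ?andbF// st.
Qed.

Lemma reach_exits S o u s : reach S o u s -> u \in exits s -> o \in exits s.
Proof.
apply: (@reach_ind _ _ _ _ (fun u => u \in exits s -> _)) => //.
by move=> x y _ ox exy sy _ ys; apply: ox; apply: exits_arc ys.
Qed.

(** * The lower bound on the sum of the influences *)

Section DuminilCopinTassion.
Variables (K : rcfType) (q : K) (o : V).
Hypothesis q01 : 0 <= q <= 1.

Let f s : K := (crosses o s)%:R.

Lemma crosses_incr : increasing (crosses o).
Proof.
move=> s t st /andP[so os]; rewrite /crosses st//=.
exact: fintype.subsetP (exits_incr st) _ os.
Qed.

Lemma influence_ge0 v s : 0 <= influence f v s.
Proof.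
rewrite subr_ge0 ler_nat.
have /(_ (update s v false) (update s v true)) := crosses_incr.
case: (crosses o (update s v false)) => //.
by move=> -> // u; rewrite !ffunE; case: eqP.
Qed.

Lemma influence_start s : o \in exits s -> influence f o s = 1.
Proof.
move=> os; rewrite /influence /f /crosses !ffunE eqxx /= subr0.
suff -> : o \in exits (update s o true) by [].
apply: fintype.subsetP os; apply: exits_incr => v sv.
by rewrite ffunE; case: eqP.
Qed.

(** The site [v] is closed, since otherwise [u] would belong to [exits s]; so [o] does not cross.
    Opening [v] completes a path from [o] through [u] and [v] to an exit. *)
Lemma influence_boundary s u v : e u v ->
  reach (~: exits s) o u s -> v \in exits s -> influence f v s = 1.
Proof.
move=> euv ou vs.
have := reach_sub ou; rewrite finset.in_setC => us.
have sv : s v = false by apply: contraNF us => sv; apply: exits_arc vs.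
have s0 : update s v false = s.
  by apply/ffunP => w; rewrite ffunE; have [->|] := eqVneq w v.
have os : o \notin exits s by case/and3P: ou => _; rewrite inE.
have st w : s w -> update s v true w by rewrite ffunE; case: eqP.
rewrite /influence /f s0 /crosses (negPf os) andbF subr0.
have -> : update s v true o by apply: st; case/and3P: ou.
suff -> : o \in exits (update s v true) by [].
apply: (reach_exits (reach_incr st ou)).
apply: (exits_arc euv); first by rewrite ffunE eqxx.
exact: fintype.subsetP (exits_incr st) _ vs.
Qed.

(** A pivotal site is counted at most once for each of its [D] or fewer predecessors. When [o] lies
    in [exits s] the double sum vanishes, and [o] itself is the pivotal site. *)
Lemma boundary_le_influence (D : nat) s :
    (0 < D)%N -> (forall v, (#|[pred u | e u v]| <= D)%N) ->
  (o \in exits s)%:R + \sum_(u in ~: exits s)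
    \sum_(v | (v \notin ~: exits s) && e u v) (reach (~: exits s) o u s)%:R
  <= D%:R * \sum_v influence f v s.
Proof.
move=> D0 De; have [os|os] := boolP (o \in exits s).
  rewrite [X in _ + X]big1 ?addr0.
    rewrite (bigD1 o)//= influence_start// mulrDr mulr1.
    rewrite -[leLHS]addr0 lerD//; first by rewrite ler1n.
    by rewrite mulr_ge0 ?ler0n// sumr_ge0// => v _; exact: influence_ge0.
  move=> u _; rewrite big1// => v _.
  by rewrite /reach finset.in_setC os andbF.
rewrite add0r mulr_sumr (exchange_big_dep xpredT)//=; apply: ler_sum => v _.
have [/existsP[u /and3P[us euv ou]]|] := boolP [exists u,
    [&& v \in exits s, e u v & reach (~: exits s) o u s]].
  rewrite (influence_boundary euv)// mulr1.
  apply: (@le_trans _ _ (#|[pred u | e u v]|%:R)); last by rewrite ler_nat.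
  rewrite -sum1_card natr_sum [leRHS](bigID (mem (~: exits s))) /=.
  rewrite -[leLHS]addr0 lerD//; last by rewrite sumr_ge0.
  rewrite big_mkcond [leRHS]big_mkcond /=; apply: ler_sum => w _.
  rewrite !finset.in_setC us /=; case: (w \in exits s); rewrite ?andbF//= inE.
  by case: (e w v) => //=; case: reach.
rewrite negb_exists => /forallP nor; rewrite big1 ?mulr_ge0 ?influence_ge0//.
move=> u; rewrite !finset.in_setC negbK => /and3P[_ vs euv].
by have := nor u; rewrite vs euv /= => /negPf->.
Qed.

(* Conditioning on [exits s = T] does not bias the configuration off [T], and
   each step out of the complement of [T] from a site reached from [o] leads to
   a pivotal site. *)
Lemma sum_influence_ge (D : nat) :
    (0 < D)%N -> (forall v, (#|[pred u | e u v]| <= D)%N) ->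
    (forall S, o \in S -> (forall x, x \in S -> ~~ b x) ->
      1 <= outflow q S o) ->
  1 <= D%:R * \sum_v expect q (influence f v).
Proof.
move=> D0 De out.
pose G T s : K := (o \in T)%:R + \sum_(u in ~: T)
    \sum_(v | (v \notin ~: T) && e u v) (reach (~: T) o u s)%:R.
apply: (@le_trans _ _ (expect q (fun s => G (exits s) s))); last first.
  rewrite -expect_sum mulr_sumr.
  under [leRHS]eq_bigr do rewrite mulrCA.
  apply: ler_sum => s _; rewrite ler_wpM2l ?weight_ge0//.
  exact: boundary_le_influence.
have -> : expect q (fun s => G (exits s) s) =
    \sum_T expect q (fun s => (exits s == T)%:R * G T s).
  rewrite -expect_sum; apply: eq_bigr => s _; congr (_ * _).
  rewrite (bigD1 (exits s))//= eqxx mul1r big1 ?addr0// => T /negPf.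
  by rewrite eq_sym => ->; rewrite mul0r.
have {1}-> : 1 = \sum_T expect q (fun s => (exits s == T)%:R).
  rewrite -expect_sum -[LHS](expect1 V q); apply: eq_bigr => s _; congr (_ * _).
  rewrite (bigD1 (exits s))//= eqxx big1 ?addr0// => T /negPf.
  by rewrite eq_sym => ->.
apply: ler_sum => T _.
(* If [T] misses a point of [b], the event [exits s = T] is impossible; this is why [out] is asked
   only of sets free of exits. *)
have [/forallP bT|] := boolP [forall x, b x ==> (x \in T)]; last first.
  rewrite negb_forall => /existsP[x]; rewrite negb_imply => /andP[bx xT].
  have nT s : (exits s == T) = false.
    by apply: contraNF xT => /eqP <-; exact: exits_exit.
  by apply: ler_expect => // s; rewrite nT mul0r.
rewrite (@expectM_indep _ _ _ T); first last.
- move=> s t st; congr (_ + _); apply: eq_bigr => u _; apply: eq_bigr => v _.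
  by rewrite (reach_local _ _ st).
- move=> s t st; congr (1 *+ nat_of_bool _); apply/eqP/eqP => sT.
    by rewrite (@exits_local s t) sT.
  by rewrite (@exits_local t s) sT// => x xT; rewrite st.
rewrite -[leLHS]mulr1; apply: ler_wpM2l; first exact: expect_ge0.
have -> : expect q (G T) = (o \in T)%:R + outflow q (~: T) o.
  rewrite /outflow /G /expect; under eq_bigr do rewrite mulrDr.
  rewrite big_split /= -mulr_suml sum_weight mul1r; congr (_ + _).
  rewrite -[LHS]/(expect q _) expect_sum; apply: eq_bigr => u _.
  by rewrite expect_sum.
have [oT|oT] := boolP (o \in T).
  rewrite lerDl; apply: sumr_ge0 => u _; apply: sumr_ge0 => v _.
  exact: prob_ge0.
rewrite add0r; apply: out; first by rewrite inE.
by move=> x; rewrite inE; apply: contraNN => bx; have := bT x; rewrite bx.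
Qed.

End DuminilCopinTassion.

(** * Cutting a path at its last exit from a cluster *)

Section Exploration.
Variables (S : {set V}) (o : V).
Hypothesis oS : o \in S.
Hypothesis Sb : forall x, x \in S -> ~~ b x.

Let cluster s : {set V} := [set u | reach S o u s].

(** The sites whose being closed certifies that the cluster stops at [C]. The point [o] is among
    them when it is not in [C], which covers the empty cluster of a closed [o]. *)
Let boundary (C : {set V}) : {set V} :=
  [set y in S | (y \notin C) && ((y == o) || [exists x in C, e x y])].

(** An event evaluated at [close Z s] depends only on the states off [Z], hence is independent of
    what is read on [Z]. *)
Let close (Z : {set V}) s : {ffun V -> bool} := [ffun x => (x \notin Z) && s x].

Let boundaryP (C : {set V}) y : reflect
  [/\ y \in S, y \notin C & y = o \/ exists2 x, x \in C & e x y]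
  (y \in boundary C).
Proof.
rewrite inE; apply: (iffP and3P) => -[yS yC yb]; split=> //.
  case/orP: yb => [/eqP|/existsP[x /andP[xC exy]]]; first by left.
  by right; exists x.
case: yb => [->|[x xC exy]]; first by rewrite eqxx.
by apply/orP; right; apply/existsP; exists x; rewrite xC.
Qed.

Let cluster_local C s t :
  {in C :|: boundary C, s =1 t} -> cluster s = C -> cluster t = C.
Proof.
move=> st sC; have stC x : x \in C -> s x = t x by move=> xC; apply: st;
  rewrite inE xC.
have stb x : x \in boundary C -> s x = t x by move=> xC; apply: st;
    rewrite inE xC orbT.
apply/setP => x; apply/idP/idP.
  rewrite inE; apply: (@reach_ind _ _ _ _ (fun u => u \in C)) =>
    [t_o _|u y _ uC euy ty yS].
    apply: contraTT t_o => oC; rewrite -stb; last by apply/boundaryP;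
      split => //; left.
    by apply: contraNN oC => so; rewrite -sC inE reach_refl.
  apply: contraTT (ty) => yC; rewrite -stb; last first.
    by apply/boundaryP; split => //; right; exists u.
  apply: contraNN yC => sy; rewrite -sC inE; apply: (reach_arc _ euy) => //.
  by move: uC; rewrite -sC inE.
rewrite -{1}sC inE; apply: (@reach_ind _ _ _ _ (fun u =>
  u \in cluster t)) => [so _|u y ou ut euy sy yS].
  by rewrite inE reach_refl// -stC// -sC inE reach_refl.
rewrite inE; apply: (reach_arc _ euy) => //; first by move: ut; rewrite inE.
by rewrite -stC// -sC inE; apply: reach_arc ou euy sy yS.
Qed.

(* A path leaving [S] is cut after its last point in the cluster of [o]; the
   rest of it avoids the cluster as well as its (closed) boundary. *)
Let crosses_exploration s : crosses o s ->
  exists u v, [/\ u \in cluster s, v \notin S, e u v &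
    crosses v (close (cluster s :|: boundary (cluster s)) s)].
Proof.
set C := cluster s; set Z := C :|: _.
(* Going back from the exit, either the path has avoided [Z] so far, or its last exit from the
   cluster has been found. *)
pose Q x := s x -> crosses x (close Z s) \/
  exists u v, [/\ u \in C, v \notin S, e u v & crosses v (close Z s)].
have CS x : x \in C -> x \in S by rewrite inE => /reach_sub.
have bC x : x \in boundary C -> s x = false.
  case/boundaryP => xS xC xb; apply: contraNF xC => sx;
    case: xb => [xo|[u uC eux]].
    by rewrite xo inE reach_refl// -xo.
  by rewrite inE; apply: (reach_arc _ eux) => //; move: uC; rewrite inE.
have QP x : x \in exits s -> Q x.
  move: x; apply: exits_ind => [x bx sx|x y exy sy ys Qy sx].
    left; rewrite /crosses exits_exit// ffunE sx !andbT.
    apply: contraTN bx => xZ; apply: Sb; move: xZ; rewrite inE => /orP[/CS//|].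
    by case/boundaryP.
  have [cy|] := Qy sy; last by right.
  have yZ : y \notin Z by case/andP: cy; rewrite ffunE => /andP[].
  have [xC|xC] := boolP (x \in C).
    right; exists x, y; split=> //; apply: contraNN yZ => yS.
    rewrite inE; apply/orP; left; rewrite inE.
    by apply: (reach_arc _ exy) => //; move: xC; rewrite inE.
  left; case/andP: cy => cy yex; rewrite /crosses (exits_arc exy)// ffunE sx.
  rewrite !andbT inE (negPf xC) /=; apply: contraTN sx => /bC ->//.
(* The point [o] is in its own cluster, hence closed in [close Z s], and only the second alternative
   is left. *)
move=> /andP[so /QP /(_ so)[|//]].
rewrite /crosses ffunE so andbT => /andP[]; rewrite inE.
by have -> : o \in C by rewrite inE reach_refl.
Qed.

(** Given that the cluster is [C], reaching [u] is read on [C] and its boundary, whereas the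
    crossing from [v] with these sites closed is read off them: the two are independent. Forgetting
    the closure only increases the second probability. *)
Lemma prob_crosses_le (K : realDomainType) (q : K) : 0 <= q <= 1 ->
  prob q (crosses o) <= \sum_(u in S) \sum_(v | (v \notin S) && e u v)
    prob q (reach S o u) * prob q (crosses v).
Proof.
move=> q01.
pose cr (C : {set V}) v s : K := (crosses v (close (C :|: boundary C) s))%:R.
pose F (u v : V) (C : {set V}) s : K :=
  (u \in C)%:R * ((cluster s == C)%:R * cr C v s).
apply: (@le_trans _ _ (expect q (fun s => \sum_(u in S)
    \sum_(v | (v \notin S) && e u v) \sum_C F u v C s))).
  apply: ler_expect => // s.
  have F0 u v C : 0 <= F u v C s by rewrite !mulr_ge0.
  case: (boolP (crosses o s)) => [/crosses_exploration|_]; last first.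
    by apply: sumr_ge0 => u _; apply: sumr_ge0 => v _; apply: sumr_ge0.
  move=> [u [v [uC vS euv cv]]].
  rewrite (bigD1 u)/=; last by move: uC; rewrite inE => /reach_sub.
  rewrite (bigD1 v)/= ?vS// (bigD1 (cluster s))//= {1}/F uC eqxx !mul1r /cr cv.
  rewrite -!addrA lerDl !addr_ge0// ?sumr_ge0// => w _.
    by rewrite sumr_ge0.
  by rewrite sumr_ge0// => w' _; rewrite sumr_ge0.
rewrite expect_sum; apply: ler_sum => u uS.
rewrite expect_sum; apply: ler_sum => v /andP[vS euv].
rewrite expect_sum.
have -> : prob q (reach S o u) =
    \sum_(C : {set V}) expect q (fun s => (u \in C)%:R * (cluster s == C)%:R).
  rewrite -expect_sum; apply: eq_bigr => s _; congr (_ * _).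
  rewrite (bigD1 (cluster s))//= eqxx mulr1 inE big1 ?addr0// => C /negPf.
  by rewrite eq_sym => ->; rewrite mulr0.
rewrite mulr_suml; apply: ler_sum => C _.
have -> : expect q (F u v C) =
    expect q (fun s => (u \in C)%:R * (cluster s == C)%:R) * expect q (cr C v).
  rewrite -(@expectM_indep _ _ _ (C :|: boundary C)).
  - by apply: eq_bigr => s _; rewrite /F mulrA.
  - move=> s t st; congr (_ * (1 *+ nat_of_bool _)); apply/eqP/eqP;
      apply: cluster_local => //.
    by move=> x xZ; rewrite st.
  - move=> s t st; rewrite /cr; congr (1 *+ nat_of_bool (crosses _ _));
      apply/ffunP => x.
    rewrite !ffunE; have [//|xZ] := boolP (x \in _); apply: st.
    by rewrite finset.in_setC.
apply: ler_wpM2l; first by rewrite expect_ge0// => s; rewrite mulr_ge0.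
apply: ler_prob => // s; apply: crosses_incr => x.
by rewrite ffunE => /andP[].
Qed.

End Exploration.
(** The derivative is at least [1 / D] at every density between [p] and [p'], because the outflow
    increases with the density; the mean value theorem concludes. *)
Lemma prob_crosses_ge (K : rcfType) (p p' : K) (o : V) (D : nat) :
    0 <= p -> p < p' -> p' <= 1 ->
    (0 < D)%N -> (forall v, (#|[pred u | e u v]| <= D)%N) ->
    (forall S, o \in S -> (forall x, x \in S -> ~~ b x) ->
      1 <= outflow p S o) ->
  p' - p <= D%:R * prob p' (crosses o).
Proof.
move=> p0 pp' p'1 D0 De out.
apply: (@le_trans _ _ (D%:R * (prob p' (crosses o) - prob p (crosses o))));
  last first.
  rewrite ler_wpM2l// gerBl prob_ge0// p0 /=; lra.
rewrite /prob -!horner_expect_poly.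
have [c + ->] := poly_mvt (expect_poly (fun s => (crosses o s)%:R)) pp'.
move=> /andP[]; rewrite /= !bnd_simp => pc cp'.
rewrite mulrA -[leLHS]mul1r ler_wpM2r//; first lra.
rewrite russo; apply: sum_influence_ge => //; first lra.
move=> S oS Sb; apply: le_trans (out _ oS Sb) _.
apply: ler_sum => u _; apply: ler_sum => v _.
by apply: prob_increasing; [exact: reach_incr|lra..].
Qed.

End Graph.

Local Open Scope classical_set_scope.
Local Open Scope ring_scope.

(** * Measurability *)

Section ProductSpace.
Context (I : Type) (dX : measure_display) (Y : measurableType dX).

Lemma measurable_coord (i : I) :
  measurable_fun [set: prodspace I Y] (fun f => f i).
Proof.
move=> _ E mE; rewrite setTI; apply: sub_sigma_algebra.
by exists i, E.
Qed.

Lemma measurable_preimage_coord (dT : measure_display) (T : measurableType dT)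
    (g : T -> prodspace I Y) (i : I) (E : set Y) :
  measurable_fun setT g -> measurable E -> measurable [set t | E (g t i)].
Proof.
move=> mg mE; rewrite -[X in measurable X]setTI.
have h := measurableT_comp (measurable_coord i) mg.
exact: h measurableT _ mE.
Qed.

Lemma measurable_fun_prodspace (dT : measure_display) (T : measurableType dT)
    (g : T -> prodspace I Y) :
  (forall i, measurable_fun setT (fun t => g t i)) -> measurable_fun setT g.
Proof.
move=> mg.
refine (@measurability _ _ _ (prodspace I Y) setT g (cylinders (X := Y)) erefl _).
move=> _ [_ [i [E [mE ->]]] <-].
exact: mg.
Qed.
End ProductSpace.

(** * Integer boxes and finiteness of the range *)

Section Box.
Variable d : nat.

Definition box (a : 'rV[int]_d) (N : nat) : {fset 'rV[int]_d} :=
  [fset (\row_i (a 0 i + (Posz (g i) - Posz N)))%R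
    | g : {ffun 'I_d -> 'I_N.*2.+1} in {: {ffun 'I_d -> 'I_N.*2.+1}}]%fset.

Lemma card_box (a : 'rV[int]_d) (N : nat) : (#|` box a N| <= N.*2.+1 ^ d)%N.
Proof.
apply: (leq_trans (leq_imfset_card _ _ _)) => /=.
by rewrite -cardE card_ffun !card_ord.
Qed.

Lemma in_box (a x : 'rV[int]_d) (N : nat) :
  (forall i, `|x 0 i - a 0 i| <= N%:Z) -> x \in box a N.
Proof.
move=> xN; apply/imfsetP.
exists [ffun i => inord (absz (x 0 i - a 0 i + N%:Z))] => //.
apply/rowP => i; rewrite mxE ffunE inordK; last by have := xN i; lia.
have /gez0_abs-> : 0 <= x 0 i - a 0 i + N%:Z by have := xN i; lia.
by rewrite addrK subrKC.
Qed.

Lemma range_box_le (K : realType) (r : K) (z : site d) : range_box r z ->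
  let N := `|Num.ceil r|%N in
  [/\ forall i, `|z.1 0 i| <= N%:Z, - N%:Z <= z.2 & z.2 < 0].
Proof.
move=> [z1 /andP[rz z0]] N.
have rN : r <= (N%:Z)%:~R.
  by rewrite (le_trans (ceil_ge r))// ler_int /N abszE ler_norm.
have bound (m : int) : m%:~R <= r -> m <= N%:Z.
  by move=> mr; rewrite -(ler_int K) (le_trans mr).
split=> // [i|]; last first.
  by rewrite lerNl; apply: bound; rewrite mulrNz lerNl.
have /andP[iz zi] := z1 i; rewrite ler_norml bound// andbT lerNl bound//.
by rewrite mulrNz lerNl.
Qed.

Lemma finite_range_box (K : realType) (r : K) : finite_set (range_box (d:=d) r).
Proof.
set N := `|Num.ceil r|%N.
pose F := [fset (x, - i%:Z)%R | x in box 0 N, i in iota 0 N.+1]%fset.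
apply: (@sub_finite_set _ _ [set` F]); last exact: finite_fset.
move=> z /range_box_le[]; rewrite -/N => z1 Nz z0; apply/imfset2P => /=.
exists z.1; first by apply: in_box => i; rewrite mxE subr0.
exists `|z.2|%N; first by rewrite inE mem_iota; move: Nz z0;
  move: N (z.2) {F z1} => N' m; lia.
case: z z1 Nz z0 => x m /= _ _ m0; congr pair; lia.
Qed.
End Box.

(** * Locality and measurability of the dynamics *)

Section Dynamics.
Context {K : realType} {d : nat} {r : K}.
Local Notation field := (field d r).
Local Notation config := (config d r).
Local Notation eta := Defs.eta.
Local Notation upset := Defs.upset.
Implicit Types (U : field) (w : config) (v z a : site d) (n t : nat).

Lemma eta_rec U w v : 0 <= v.2 ->
  eta U w v = `[< upset (U v) [set z | range_box r z /\ eta U w (v + z)] >].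
Proof. by case: v => x [t|//] _; exact: eta_step. Qed.

Lemma eta_slab U w v (vs : (- r <= v.2%:~R) && (v.2 < 0)) :
  eta U w v = w (exist _ v vs).
Proof. exact: (eta_init U w (exist _ v vs)). Qed.

Lemma eta_local U U' w v : (forall z, z.2 <= v.2 -> U z = U' z) ->
  eta U w v = eta U' w v.
Proof.
rewrite /Defs.eta; move: (absz v.2).+1 => n; elim: n v => [//|n IH] v UU' /=.
rewrite IH//; case: eqP => // _; rewrite UU'//; congr (`[< _ _ >]).
have vz z : range_box r z -> forall y, y.2 <= (v + z).2 -> U y = U' y.
  move=> [_ /andP[_ z0]] y yvz; apply: UU'; rewrite (le_trans yvz)//=.
  by rewrite gerDl ltW.
by apply/seteqP; split=> z /= [Rz]; rewrite (IH (v + z) (vz _ Rz)).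
Qed.

(** Field and initial configuration are both functions of [x], so that the same statement serves for
    a fixed start, for translated fields and on the product space. *)
Lemma measurable_eta (dT : measure_display) (T : measurableType dT)
    (f : T -> field) (g : T -> config) v :
  measurable_fun setT f -> measurable_fun setT g ->
  measurable [set x | eta (f x) (g x) v].
Proof.
move=> mf mg; rewrite /Defs.eta; move: (absz v.2).+1 => n;
  elim: n v => [|n IH] v /=.
  case: insubP => [v' _ _|_]; last first.
    by rewrite (_ : [set _ | _] = set0)//; apply/seteqP; split.
  exact: (@measurable_preimage_coord _ _ _ _ _ g v' [set true] mg).
case: eqP => // _.
pose Y x := [set z | range_box r z /\ traj (f x) (g x) n (v + z)].
(* The set of active neighbours lies in the finite range, so it takes countably many values [F], and
   for each of them the condition at [v] concerns the single coordinate [f x v]. *)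
rewrite [X in measurable X](_ : _ = \bigcup_(F : {fset site d})
  ([set x | upset (f x v) [set` F]] `&` [set x | Y x = [set` F]])); last first.
  apply/seteqP; split=> [x /asboolP fY|x [F _ [/= + YF]]]; last first.
    by rewrite -YF => fY; apply/asboolP.
  have Yfin : finite_set (Y x).
    by apply: sub_finite_set (finite_range_box d r) => z [].
  by exists (fset_set (Y x)) => //=; split; rewrite /= fset_setK.
apply: countable_bigcupT_measurable; first exact: countableP.
move=> F; apply: measurableI.
  exact: (@measurable_preimage_coord _ _ _ _ _ f v [set W | upset W [set` F]]
    mf).
have [FR|FR] := pselect ([set` F] `<=` range_box r); last first.
  rewrite (_ : [set _ | _] = set0)//; apply/seteqP; split=> x //= YF.
  by apply: FR; rewrite -YF => z [].
rewrite [X in measurable X](_ : _ = \bigcap_(z in range_box r)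
   [set x | traj (f x) (g x) n (v + z) = (z \in F)]); last first.
  apply/seteqP; split=> x /= YF.
    move=> z Rz; apply/idP/idP => [h|zF].
      by have : Y x z by []; rewrite YF.
    by have [] : Y x z by rewrite YF.
  apply/seteqP; split=> z.
    by move=> [Rz h] /=; rewrite -YF.
  by move=> zF; split; [exact: FR|rewrite YF//; exact: FR].
apply: fin_bigcap_measurable; first exact: finite_range_box.
move=> z _; case: (z \in F); first exact: IH.
rewrite (_ : [set _ | _] = ~` [set x | traj (f x) (g x) n (v + z)]).
  exact/measurableC/IH.
apply/seteqP; split=> x /=; [by move=> ->|by move=> /negP/negPf].
Qed.

Lemma measurable_eta_init w v : measurable [set U | eta U w v].
Proof.
apply: (@measurable_eta _ _ id (fun=> w)); first exact: measurable_id.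
exact: measurable_cst.
Qed.

End Dynamics.

(** * Laws of i.i.d. fields *)

Section ProductLaw.
Context {K : realType} {d : nat} {r : K}.
Local Notation field := (field d r).
Implicit Types (U : field) (v z a : site d) (u : attractive_pca d r).
Implicit Types (J : {fset site d}) (E : site d -> set (upfamily d r)).

Definition rect J E : set field := [set U | forall v, v \in J -> E v (U v)].

(* [iid_law] for measures that are not bundled as probabilities. *)
Definition product_law u (m : set field -> \bar K) : Prop :=
  forall J E, m (rect J E) = (\prod_(v <- J) u (E v))%E.

Lemma measurable_rect J E : measurable (rect J E).
Proof.
rewrite [X in measurable X](_ : _ = \bigcap_(v in [set` J]) [set U | E v (U
  v)])//.
apply: fin_bigcap_measurable => [|v _]; first exact: finite_fset.
exact: (@measurable_preimage_coord _ _ _ _ _ id v (E v)).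
Qed.

(** The rectangles are stable under intersection, generate the product sigma-algebra and include the
    whole space. *)
Lemma product_law_unique u (m m' : {measure set field -> \bar K}) :
  product_law u m -> product_law u m' ->
  forall B, measurable B -> m B = m' B.
Proof.
move=> um um' B mB.
pose G : set (set field) := [set C | exists J E, C = rect J E].
have GT : setT = rect fset0 (fun=> setT) by apply/seteqP; split.
apply: (measure_unique G (fun=> setT)) => //.
- apply/seteqP; split; apply: smallest_sub.
  + exact: smallest_sigma_algebra.
  + move=> _ [i [E [_ ->]]]; apply: sub_sigma_algebra.
    exists [fset i]%fset, (fun=> E); apply/seteqP; split=> U /=.
      by move=> EU v /fset1P ->.
    by apply; rewrite fset11.
  + exact: sigma_algebra_measurable.
  + by move=> _ [J [E ->]]; exact: measurable_rect.
- move=> _ _ [J [E ->]] [J' [E' ->]].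
  exists (J `|` J')%fset,
    (fun v => [set W | (v \in J -> E v W) /\ (v \in J' -> E' v W)]).
  apply/seteqP; split=> U /=.
    by move=> [JE JE'] v _; split; [exact: JE|exact: JE'].
  by move=> JE; split=> v vJ; have [] := JE v; rewrite ?inE ?vJ ?orbT//;
    [move=> + _|move=> _]; apply.
- by move=> k; exists fset0, (fun=> setT).
- by rewrite bigcup_const//; exists 0%N.
- by move=> _ [J [E ->]]; rewrite um um'.
- by move=> _; rewrite GT um big_seq_fset0 ltry.
Qed.

Definition translate a U : field := fun v => U (v + a).

Lemma measurable_translate a : measurable_fun setT (translate a).
Proof.
by apply: measurable_fun_prodspace => v; exact: measurable_coord.
Qed.

Lemma product_law_translate u (P : probability field K) a : iid_law u P ->
  forall B, measurable B -> P (translate a @^-1` B) = P B.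
Proof.
move=> uP B mB.
apply: (@product_law_unique u (pushforward P (translate a)) P _ uP) => //.
  exact: measurable_translate.
move=> ? J E; rewrite /= /pushforward.
have -> : translate a @^-1` rect J E =
    rect [fset (v + a)%R | v in J]%fset (fun v => E (v - a)).
  apply/seteqP; split=> U /= JE v.
    by move=> /imfsetP[w /= wJ ->]; rewrite addrK; exact: JE.
  by move=> vJ; have := JE (v + a); rewrite addrK; apply; exact: in_imfset.
rewrite uP big_imfset /=; last by move=> v w _ _ /addIr.
by apply: eq_bigr => v _; rewrite addrK.
Qed.

(** Glues the field that produced the initial configuration to the independent field that drives the
    process from time 0 on. *)
Definition splice (UU : field * field) : field :=
  fun v => if v.2 < 0 then UU.1 v else UU.2 v.

Lemma measurable_splice : measurable_fun setT splice.
Proof.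
apply: measurable_fun_prodspace => v; rewrite /splice; case: (v.2 < 0).
  exact: (measurableT_comp (measurable_coord v) measurable_fst).
exact: (measurableT_comp (measurable_coord v) measurable_snd).
Qed.

Lemma product_law_splice u (P P' : probability field K) :
  iid_law u P -> iid_law u P' ->
  forall B, measurable B -> (P \x P')%E (splice @^-1` B) = P B.
Proof.
move=> uP uP' B mB.
apply: (@product_law_unique u (pushforward (P \x P')%E splice) P _ uP) => //.
  exact: measurable_splice.
move=> ? J E; rewrite /= /pushforward.
pose E1 v := if v.2 < 0 then E v else setT.
pose E2 v := if v.2 < 0 then setT else E v.
have -> : splice @^-1` rect J E = rect J E1 `*` rect J E2.
  apply/seteqP; split=> -[U1 U2] /=.
    by move=> JE; split=> v /JE; rewrite /E1 /E2 /splice; case: ifP.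
  by move=> [JE1 JE2] v vJ; have := (JE1 v vJ, JE2 v vJ);
    rewrite /E1 /E2 /splice; case: ifP => _ [].
rewrite product_measure1E; [|exact: measurable_rect..].
rewrite [X in (X * _)%E](uP J E1) [X in (_ * X)%E](uP' J E2) -big_split /=;
  apply: eq_bigr => v _.
by rewrite /E1 /E2; case: ifP; rewrite probability_setT ?mule1 ?mul1e.
Qed.

End ProductLaw.

(** * The invariant measure started from the infinite past *)

Lemma ltz_pred (m m' : int) (k : nat) : m < m' -> m' < k.+1%:Z -> m < k%:Z.
Proof. lia. Qed.

Section Zeta.
Context {K : realType} {d : nat} {r : K}.
Local Notation field := (field d r).
Local Notation config := (config d r).
Local Notation eta := Defs.eta.
Local Notation upset := Defs.upset.
Implicit Types (U : field) (v z a : site d) (u : attractive_pca d r).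

Definition time (n : nat) : site d := (0, n%:Z).

(* The process started from [config1] in the window preceding time [- n]. *)
Definition past n U v : bool :=
  eta (translate (- time n) U) (config1 r) (v + time n).

Lemma past_rec n U v : 0 <= v.2 + n%:Z ->
  past n U v = `[< upset (U v) [set z | range_box r z /\ past n U (v + z)] >].
Proof.
move=> vn; rewrite /past eta_rec// /translate addrK; congr (`[< _ _ >]).
by apply/seteqP; split=> z /=; rewrite addrAC.
Qed.

Lemma past_start n U v : - r <= (v.2 + n%:Z)%:~R -> v.2 + n%:Z < 0 ->
  past n U v.
Proof.
move=> rv vn; rewrite /past.
by have vs : (- r <= (v + time n).2%:~R) && ((v + time n).2 < 0);
  [rewrite /= rv|rewrite (eta_slab _ _ vs)].
Qed.

Lemma range_boxD n v z : 0 <= v.2 + n%:Z -> range_box r z ->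
  - r <= ((v + z).2 + n%:Z)%:~R.
Proof.
move=> vn [_ /andP[rz _]]; apply: (le_trans rz).
by rewrite ler_int /= addrAC lerDr.
Qed.

Lemma range_box_lt v z : range_box r z -> (v + z).2 < v.2.
Proof. by move=> [_ /andP[_ z0]]; rewrite /= gtrDl. Qed.

Lemma past_local n U U' v : (forall z, z.2 <= v.2 -> U z = U' z) ->
  past n U v = past n U' v.
Proof.
move=> UU'; apply: eta_local => z zv; apply: UU'.
by move: zv => /=; rewrite lerBlDr.
Qed.

Lemma past_shift m t U v :
  past (m + t) (translate (time t) U) v = past m U (v + time t).
Proof.
rewrite /past.
have E : time (m + t) = time t + time m by rewrite /time; congr pair;
    rewrite ?addr0// PoszD addrC.
rewrite -addrA -E; congr eta.
by apply/funext => z; rewrite /translate E opprD addrA addrAC subrK.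
Qed.

(** Started earlier, the process is at most all ones in the later starting window, and
    attractiveness propagates this comparison forward in time. *)
Lemma past_anti n m U v : (n <= m)%N -> - r <= (v.2 + n%:Z)%:~R ->
  past m U v -> past n U v.
Proof.
(* The bound [k] on the time of [v] serves only as the induction variable, here and in the similar
   proofs below. *)
move=> nm; have [k] : exists k : nat, v.2 + n%:Z < k%:Z.
  by exists (absz v.2 + n).+1; lia.
elim: k v => [|k IH] v vk rv; first by move=> _; exact: past_start.
have [vn|vn] := ltP (v.2 + n%:Z) 0; first by move=> _; exact: past_start.
rewrite !past_rec//; last lia.
move=> /asboolP h; apply/asboolP; apply: Defs.upset_up h _ _ => z [] //.
move=> Rz pz; split=> //; apply: IH pz; last exact: range_boxD.
by apply: ltz_pred vk; rewrite ltrD2r; exact: range_box_lt.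
Qed.

(* The process started from [config1] at time [- oo]. *)
Definition zeta U v : bool := `[< forall n, past n U v >].

Lemma zeta_local U U' v : (forall z, z.2 <= v.2 -> U z = U' z) ->
  zeta U v = zeta U' v.
Proof.
move=> UU'; congr (`[< _ >]); apply/propext; split => h n.
  by rewrite -(past_local n UU').
by rewrite (past_local n UU').
Qed.

Lemma zeta_shift t U v : - r <= v.2%:~R ->
  zeta (translate (time t) U) v = zeta U (v + time t).
Proof.
move=> rv; congr (`[< _ >]); apply/propext; split => h n.
  by rewrite -past_shift.
(* After the shift only the starting times [n + t] are known; the others follow by monotonicity in
   the starting time. *)
apply: (@past_anti n (n + t)); rewrite ?leq_addr ?past_shift//.
by rewrite (le_trans rv)// ler_int lerDl.
Qed.

(** The decreasing limit over starting times passes through the update because the range is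
    finite. *)
Lemma zeta_rec U v : 0 <= v.2 ->
  zeta U v = `[< upset (U v) [set z | range_box r z /\ zeta U (v + z)] >].
Proof.
move=> v0; have vn n : 0 <= v.2 + n%:Z by lia.
apply/asboolP/asboolP => [h|h n]; last first.
  rewrite past_rec//; apply/asboolP; apply: Defs.upset_up h _ _ => z [] //.
  by move=> Rz /asboolP.
(* A neighbour in state 0 for [zeta] is already in state 0 for some starting time; the maximum [N]
   of these times over the range serves all neighbours at once. *)
have bad z : exists n, past n U (v + z) -> zeta U (v + z).
  have [|/existsNP[n zn]] := pselect (forall n, past n U (v + z)).
    by move=> /asboolP h'; exists 0%N.
  by exists n.
pose N := \max_(z <- fset_set (range_box r)) sval (cid (bad z)).
have := h N; rewrite past_rec// => /asboolP /Defs.upset_up; apply;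
    last by move=> z [].
move=> z [Rz pz]; split=> //; apply: (svalP (cid (bad z))).
apply: past_anti pz; last exact: range_boxD.
have zR : z \in fset_set (range_box (d:=d) r).
  by rewrite in_fset_set ?inE//; exact: finite_range_box.
by rewrite /N (big_fsetD1 z zR) /= leq_maxl.
Qed.

Definition zeta_window U : config := fun x : slab d r => zeta U (val x).

(** At negative times [zeta] sees only the first field, and from time 0 on both sides obey the same
    recursion driven by the second. *)
Lemma eta_zeta (UU : field * field) v : - r <= v.2%:~R ->
  eta UU.2 (zeta_window UU.1) v = zeta (splice UU) v.
Proof.
have [k] : exists k : nat, v.2 < k%:Z by exists (absz v.2).+1; lia.
elim: k v => [|k IH] v vk rv.
  have vs : (- r <= v.2%:~R) && (v.2 < 0) by rewrite rv.
  rewrite (eta_slab _ _ vs); apply: zeta_local => z zv.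
  by rewrite /splice (le_lt_trans zv).
have [v0|v0] := ltP v.2 0.
  have vs : (- r <= v.2%:~R) && (v.2 < 0) by rewrite rv.
  rewrite (eta_slab _ _ vs); apply: zeta_local => z zv.
  by rewrite /splice (le_lt_trans zv).
have sv : splice UU v = UU.2 v by rewrite /splice ltNge v0.
rewrite eta_rec// zeta_rec// sv; congr (`[< _ _ >]).
have vR z : range_box r z -> - r <= (v + z).2%:~R.
  by move=> Rz; rewrite -[(v + z).2]addr0 range_boxD// addr0.
by apply/seteqP; split=> z /= [Rz]; rewrite IH ?vR//;
  exact: ltz_pred (range_box_lt _ Rz) vk.
Qed.

Lemma measurable_past n v : measurable [set U | past n U v].
Proof.
apply: (@measurable_eta _ _ _ _ _ (translate (- time n)) (fun=> config1 r)).
  exact: measurable_translate.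
exact: measurable_cst.
Qed.

Lemma measurable_zeta v : measurable [set U | zeta U v].
Proof.
rewrite [X in measurable X](_ : _ = \bigcap_n [set U | past n U v]).
  by apply: bigcapT_measurable => n; exact: measurable_past.
apply/seteqP; split=> U /=; first by move=> /asboolP h n _; exact: h.
by move=> h; apply/asboolP => n; exact: h.
Qed.

Lemma measurable_zeta_window : measurable_fun setT zeta_window.
Proof.
apply: measurable_fun_prodspace => v.
apply: (measurable_fun_bool true); rewrite setTI.
exact: measurable_zeta.
Qed.

End Zeta.

(** * Consequences of the uniqueness of the invariant measure *)

Section Uniqueness.
Context {K : realType} {d : nat} {r : K}.
Local Notation field := (field d r).
Local Notation config := (config d r).
Local Notation eta := Defs.eta.
Implicit Types (U : field) (v z a : site d) (u : attractive_pca d r).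

Let zeta_mfun : {mfun field >-> config} :=
  HB.pack (@zeta_window K d r) (isMeasurableFun.Build _ _ _ _ _
    (@measurable_zeta_window K d r)).

Definition zeta_law (P : probability field K) : probability config K :=
  distribution P zeta_mfun.

Lemma measurable_eta_window (dT : measure_display) (T : measurableType dT)
    (f : T -> field) (g : T -> config) t :
  measurable_fun setT f -> measurable_fun setT g ->
  measurable_fun setT (fun x => eta_window (f x) (g x) t : config).
Proof.
move=> mf mg; apply: measurable_fun_prodspace => v.
apply: (measurable_fun_bool true); rewrite setTI.
exact: measurable_eta.
Qed.

Lemma eta_window_zeta (UU : field * field) t :
  eta_window UU.2 (zeta_window UU.1) t =
  zeta_window (translate (time t) (splice UU)).
Proof.
apply/funext => x; have /andP[rx x0] := valP x.
rewrite /zeta_window zeta_shift// -eta_zeta.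
  by rewrite /eta_window; congr (eta _ _ _); rewrite /time; congr pair;
    [rewrite addr0|rewrite addrC].
by rewrite (le_trans rx)// ler_int lerDl.
Qed.

(** By [eta_window_zeta], the window before time [t] is that of [zeta] for a spliced and then
    translated field, and both operations preserve the i.i.d. law. *)
Lemma invariant_zeta_law u (P : probability field K) :
  iid_law u P -> Defs.invariant u (zeta_law P).
Proof.
move=> uP P' uP' t B mB.
pose C : set (config * field) := [set z | B (eta_window z.2 z.1 t)].
have mC : measurable C.
  rewrite -[C]setTI; apply: (measurable_eta_window t measurable_snd
    measurable_fst) => //.
have mZ : measurable (@zeta_window K d r @^-1` B).
  by rewrite -[X in measurable X]setTI; exact: measurable_zeta_window.
have mTZ : measurable (translate (time t) @^-1` (@zeta_window K d r @^-1` B)).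
  by rewrite -[X in measurable X]setTI; exact: measurable_translate.
transitivity ((P \x P')%E
    (splice @^-1` (translate (time t) @^-1` (@zeta_window K d r @^-1` B)))).
  rewrite -[LHS]/(\int[zeta_law P]_w (P' \o xsection C) w)%E.
  rewrite [LHS]ge0_integral_pushforward//;
    last exact: measurable_fun_xsection.
  apply: eq_integral => U _ /=; congr (P' _).
  by apply/seteqP; split=> U' /xsectionP h; apply/xsectionP; move: h;
    rewrite /C /= -(eta_window_zeta (U, U')).
by rewrite (product_law_splice uP uP')// (product_law_translate _ uP).
Qed.

(* If there were no such field, then every measure would be invariant. *)
Lemma exists_iid_law u : 1 <= r -> unique_invariant0 u ->
  exists P : probability field K, iid_law u P.
Proof.
move=> r1 [_ uniq]; apply: contrapT => noP.
have vs : (- r <= (-1%R : int)%:~R) && (-1 < 0 :> int) by rewrite lerN2 r1.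
pose x : slab d r := exist _ (0, -1) vs.
pose B : set config := [set w | w x].
have mB : measurable B.
  exact: (@measurable_preimage_coord _ _ _ _ _ id x [set true]).
have inv : Defs.invariant u (dirac (config1 r)) by move=> P uP; case: noP;
    exists P.
have := uniq _ inv B mB;
    rewrite [LHS]diracE [RHS]diracE mem_set// memNset// => /eqP.
by rewrite eqe oner_eq0.
Qed.

Lemma zeta_null u (P : probability field K) : 1 <= r -> unique_invariant0 u ->
  iid_law u P -> P [set U | zeta U (0, -1)] = 0%E.
Proof.
move=> r1 [_ uniq] uP.
have vs : (- r <= (-1%R : int)%:~R) && (-1 < 0 :> int) by rewrite lerN2 r1.
pose x : slab d r := exist _ (0, -1) vs.
pose B : set config := [set w | w x].
have mB : measurable B.
  exact: (@measurable_preimage_coord _ _ _ _ _ id x [set true]).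
have := uniq (zeta_law P) (invariant_zeta_law uP) B mB.
by rewrite diracE memNset.
Qed.

(** Translating time by [n + 1] identifies the state at time [n] with the state at time [-1] of the
    process started at time [- (n + 1)]. These events decrease to [zeta U (0, -1)], which is null by
    uniqueness. *)
Lemma eta_extinction u (P : probability field K) (e : K) : 1 <= r -> 0 < e ->
  unique_invariant0 u -> iid_law u P ->
  exists n, (P [set U | eta U (config1 r) (time n)] < e%:E)%E.
Proof.
move=> r1 e0 uniq uP.
pose F n : set field := [set U | past n.+1 U (0, -1)].
have mF n : measurable (F n) by exact: measurable_past.
have FE : \bigcap_n F n = [set U | zeta U (0, -1)].
  apply/seteqP; split=> U /=.
    move=> h; apply/asboolP => -[|n]; last exact: (h n).
    apply: (@past_anti _ _ _ 0 1 _ _ _ _ (h 0%N I)) => //.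
    by rewrite addr0 lerN2.
  by move=> /asboolP h n _; exact: h.
have mI : measurable (\bigcap_n F n) by exact: bigcapT_measurable.
have niF : nonincreasing_seq F.
  move=> n m nm; apply/subsetPset => U; apply: past_anti => //.
  by apply: (@le_trans _ _ 0); [lra|rewrite ler0z /=; lia].
have PF : P \o F @ \oo --> 0%E.
  rewrite -(zeta_null r1 uniq uP) -FE; apply: nonincreasing_cvg_mu => //.
  by rewrite (le_lt_trans (probability_le1 _ _)) ?ltry.
have PFE n : P (F n) = P [set U | eta U (config1 r) (time n)].
  rewrite -[RHS](product_law_translate (- time n.+1) uP); last first.
    exact: measurable_eta_init.
  have E : ((0, -1) : site d) + time n.+1 = time n.
    have ne : -1 + n.+1%:Z = n%:Z by lia.
    by rewrite /time -ne; congr pair; exact: addr0.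
  by congr (P _); apply/seteqP; split=> U; rewrite /F /= /past E.
have [_ /cvgr_lt /(_ _ e0)[N _ /(_ N (leqnn N))]] := (fine_cvgP _ _).1 PF.
rewrite /= PFE => Ne; exists N.
rewrite -[X in (X < _)%E]fineK ?lte_fin// fin_num_measure// -?PFE//.
exact: measurable_eta_init.
Qed.
Lemma eta_space_translate (x : 'rV[int]_d) U v : - r <= v.2%:~R ->
  eta (translate (x, 0) U) (config1 r) v = eta U (config1 r) (v + (x, 0)).
Proof.
have [k] : exists k : nat, v.2 < k%:Z by exists (absz v.2).+1; lia.
have v2 (y : site d) : (y + (x, 0)).2 = y.2 by exact: addr0.
elim: k v => [|k IH] v vk rv.
  have vs : (- r <= v.2%:~R) && (v.2 < 0) by rewrite rv.
  have vs' : (- r <= (v + (x, 0)).2%:~R) && ((v + (x, 0)).2 < 0) by rewrite v2.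
  by rewrite (eta_slab _ _ vs) (eta_slab _ _ vs').
have [v0|v0] := ltP v.2 0.
  have vs : (- r <= v.2%:~R) && (v.2 < 0) by rewrite rv.
  have vs' : (- r <= (v + (x, 0)).2%:~R) && ((v + (x, 0)).2 < 0) by rewrite v2.
  by rewrite (eta_slab _ _ vs) (eta_slab _ _ vs').
rewrite eta_rec// eta_rec ?v2//; congr (`[< _ _ >]).
have vR z : range_box r z -> - r <= (v + z).2%:~R.
  move=> Rz; rewrite -[X in X%:~R](addr0 (v + z).2).
  by apply: (@range_boxD _ _ _ 0) => //; rewrite addr0.
have E z : range_box r z -> eta (translate (x, 0) U) (config1 r) (v + z) =
    eta U (config1 r) (v + (x, 0) + z).
  by move=> Rz; rewrite addrAC; apply: IH;
    [exact: ltz_pred (range_box_lt _ Rz) vk|exact: vR].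
by apply/seteqP; split=> z /= [Rz]; rewrite E.
Qed.

Lemma prob_eta_space u (P : probability field K) v : iid_law u P ->
  0 <= v.2 -> 0 <= r ->
  P [set U | eta U (config1 r) v] =
  P [set U | eta U (config1 r) (time (absz v.2))].
Proof.
move=> uP v0 r0; rewrite -[RHS](product_law_translate (v.1, 0) uP); last first.
  exact: measurable_eta_init.
have E : time (absz v.2) + (v.1, 0) = v.
  case: v v0 => x m /= m0; congr pair; first exact: add0r.
  by rewrite -[RHS](gez0_abs m0); exact: addr0.
have rv : - r <= (time (d := d) (absz v.2)).2%:~R.
  by apply: (@le_trans _ _ 0); [rewrite oppr_le0|rewrite ler0z].
by congr (P _); apply/seteqP; split=> U /=; rewrite eta_space_translate// E.
Qed.

End Uniqueness.

(** * Percolation in finite windows *)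

Section Percolation.
Context {K : realType} {d : nat} {r : K}.
Local Notation field := (field d r).
Local Notation config := (config d r).
Local Notation eta := Defs.eta.
Local Notation upset := Defs.upset.
Variables (X : set (site d)) (p : {i01 K}).
Hypothesis XR : X `<=` range_box r.
Hypothesis X0 : X !=set0.
Implicit Types (U : field) (w : config) (v z a : site d).

Definition opened U v : bool := `[< U v = up_meets r X >].

(** Arbitrary fields may take other up-families as values; almost every field is regular, and
    [le_prob_regular] allows events to be compared on regular fields alone. *)
Definition regular U : Prop :=
  forall v, U v = up_meets r X \/ U v = up_empty d r.

(** For empty [X] both up-families would be empty and [opened] would not be Bernoulli of parameter
    [p]; that case is left to [eta_null]. *)
Lemma up_meets_neq_empty : up_meets r X <> up_empty d r.
Proof.
case: X0 => x Xx e; have : upset (up_meets r X) X.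
  by split=> //; exists x.
by rewrite e.
Qed.

Lemma gospE (E : set (upfamily d r)) : gosp r X p E =
  (p%:num * (up_meets r X \in E)%:R +
   (1 - p%:num) * (up_empty d r \in E)%:R)%:E.
Proof. by rewrite /gosp measure_addE /= /mscale /= !diracE -!EFinM -EFinD. Qed.

Lemma gosp_opened c : gosp r X p [set W | `[< W = up_meets r X >] = c] =
  (if c then p%:num else 1 - p%:num)%:E.
Proof.
rewrite gospE; congr EFin; case: c.
  rewrite mem_set/=; last exact/asboolP.
  rewrite memNset/= ?mulr1 ?mulr0 ?addr0//.
  by move/asboolP => e; exact/up_meets_neq_empty.
rewrite memNset/=; last by rewrite asboolT.
rewrite mem_set/= ?mulr1 ?mulr0 ?add0r//.
by apply/asboolP => e; exact/up_meets_neq_empty.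
Qed.

Section Window.
Variables (W : finType) (i : W -> site d).
Hypothesis inj_i : injective i.

Definition window U : {ffun W -> bool} := [ffun x => opened U (i x)].

Let J := [fset i x | x in W]%fset.

Let E (s : {ffun W -> bool}) v : set (upfamily d r) :=
  [set F | forall x, i x = v -> `[< F = up_meets r X >] = s x].

Let EiE s x : E s (i x) = [set F | `[< F = up_meets r X >] = s x].
Proof. by apply/seteqP; split=> F /=; [exact|move=> Fx y /inj_i->]. Qed.

Let rectE s : rect J (E s) = [set U | window U = s].
Proof.
apply/seteqP; split=> U /= h.
  apply/ffunP => x; rewrite ffunE.
  by have := h (i x); rewrite EiE; apply; apply: in_imfset.
by move=> _ /imfsetP[x /= _ ->]; rewrite EiE -h ffunE.
Qed.

Let window_bigcup (f : pred {ffun W -> bool}) :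
  [set U | f (window U)] = \bigcup_(s in [set` enum f]) rect J (E s).
Proof.
apply/seteqP; split=> U /=.
  by move=> fU; exists (window U); rewrite ?rectE//= mem_enum.
by move=> [s /=]; rewrite mem_enum rectE /= => fs ->.
Qed.

Lemma measurable_window (f : pred {ffun W -> bool}) :
  measurable [set U | f (window U)].
Proof.
rewrite window_bigcup; apply: fin_bigcup_measurable => // s _.
exact: measurable_rect.
Qed.

(** The passage from the infinite field to a finite Bernoulli product: the possible values of the
    window are disjoint rectangles, each of measure its weight. *)
Lemma prob_window (P : probability field K) (f : pred {ffun W -> bool}) :
  iid_law (gosp r X p) P ->
  P [set U | f (window U)] = (prob p%:num f)%:E.
Proof.
move=> uP; have PE s : P (rect J (E s)) = (weight p%:num s)%:E.
  rewrite [LHS](uP J (E s)) big_imfset /=; last by move=> ? ? _ _; exact: inj_i.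
  rewrite /weight -prodEFin big_enum /=; apply: eq_bigr => x _.
  by rewrite EiE gosp_opened.
rewrite window_bigcup measure_fin_bigcup//; first last.
- by move=> s _; exact: measurable_rect.
- by move=> s t _ _ [U []]; rewrite !rectE /= => -> ->.
rewrite -fsbig_seq ?enum_uniq//= (eq_bigr (fun s => (weight p%:num s)%:E));
  last by [].
rewrite sumEFin big_enum /= /prob /expect big_mkcond /=; congr EFin.
by apply: eq_bigr => s _; rewrite unfold_in; case: (f s); rewrite ?mulr1 ?mulr0.
Qed.

End Window.

Lemma eta_regular U w v : regular U -> 0 <= v.2 ->
  eta U w v <-> opened U v /\ exists2 z, X z & eta U w (v + z).
Proof.
move=> rU v0; rewrite eta_rec//; split.
  move/asboolP; rewrite /opened; have [->|->//] := rU v.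
  by move=> [_ [z [[Rz ez] Xz]]]; split; [exact/asboolP|exists z].
move=> [/asboolP -> [z Xz ez]]; apply/asboolP; split; first by move=> ? [].
by exists z; split=> //; split=> //; exact: XR.
Qed.

(** Follow an open path from [v] down to a point of [A]: each step goes back by at least one unit of
    time and moves each space coordinate by at most the integer range. *)
Lemma eta_ancestor U (A : {fset slab d r}) v :
  regular U -> - r <= v.2%:~R -> eta U (config_of A) v ->
  eta U (config1 r) v /\
  exists2 a, a \in A & forall i,
    `|v.1 0 i - (val a).1 0 i| <= (`|Num.ceil r|%N)%:Z * (v.2 - (val a).2).
Proof.
move=> rU; set N := (`|_|%N)%:Z.
have [k] : exists k : nat, v.2 < k%:Z by exists (absz v.2).+1; lia.
have slabP (w : site d) : - r <= w.2%:~R -> w.2 < 0 -> eta U (config_of A) w ->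
    eta U (config1 r) w /\ exists2 a, a \in A & forall i,
    `|w.1 0 i - (val a).1 0 i| <= N * (w.2 - (val a).2).
  move=> rw w0; have ws : (- r <= w.2%:~R) && (w.2 < 0) by rewrite rw.
  rewrite !(eta_slab _ _ ws) => wA; split=> //.
  by exists (exist _ w ws) => // i; rewrite /= !subrr normr0 mulr0.
elim: k v => [|k IH] v vk rv; first exact: slabP.
have [v0|v0] := ltP v.2 0; first exact: slabP.
move=> /(eta_regular _ rU v0)[ov [z Xz ez]].
have rz : - r <= (v + z).2%:~R.
  rewrite -[X in X%:~R](addr0 (v + z).2).
  by apply: (@range_boxD _ _ _ 0); [rewrite addr0|exact: XR].
have [e1 [a aA az]] := IH _ (ltz_pred (range_box_lt _ (XR Xz)) vk) rz ez.
split; first by apply/(eta_regular _ rU v0); split=> //; exists z.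
exists a => // i; have [zN _ z0] := range_box_le (XR Xz).
have := az i; have := zN i;
    rewrite -/N [(v + z).1]/(v.1 + z.1) mxE [(v + z).2]/(v.2 + z.2).
have N0 : 0 <= N by [].
move: (v.1 0 i) (z.1 0 i) ((val a).1 0 i) (v.2) (z.2) z0 ((val a).2) =>
  x y b m m' m0 s.
have : N * m' <= - N by nia.
by rewrite mulrBr mulrDr mulrBr; move: (N * m) (N * m') (N * s) => ? ? ?; lia.
Qed.

Section Law.
Variable P : probability field K.
Hypothesis uP : iid_law (gosp r X p) P.

Let irregular v : set field :=
  [set U | (~` [set up_meets r X; up_empty d r]) (U v)].

Let irregular0 v : P (irregular v) = 0%E.
Proof.
have -> : irregular v = rect [fset v]%fset
    (fun=> ~` [set up_meets r X; up_empty d r]).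
  apply/seteqP; split=> U /= h; last exact/h/fset11.
  by move=> w /fset1P ->.
rewrite [LHS]uP big_seq_fset1 [LHS]gospE !memNset/= ?mulr0 ?addr0//.
  by move=> /=; apply; right.
by move=> /=; apply; left.
Qed.

Lemma le_prob_regular (A B : set field) : measurable A -> measurable B ->
  (forall U, regular U -> A U -> B U) -> (P A <= P B)%E.
Proof.
move=> mA mB AB.
(* Sites are enumerated by their codes; a number that codes no site contributes the empty set. *)
pose F n : set field := oapp irregular set0 (choice.unpickle n).
have mF n : measurable (F n).
  rewrite /F; case: (choice.unpickle n) => //= v.
  exact: (@measurable_preimage_coord _ _ _ _ _ id v (~` [set up_meets r X;
    up_empty d r])).

have F0 : P (\bigcup_n F n) = 0%E.
  apply/negligibleP; first exact: bigcupT_measurable.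
  apply: negligible_bigcup => n; apply/negligibleP => //.
  by rewrite /F; case: (choice.unpickle n) => [v|] /=; rewrite ?irregular0.
apply: (@le_trans _ _ (P (B `|` \bigcup_n F n))).
  apply: le_measure; rewrite ?inE//.
    by apply: measurableU => //; exact: bigcupT_measurable.
  move=> U AU; have [rU|] := pselect (regular U); first by left; exact: AB.
  move=> /existsNP[v /not_orP[v1 v2]]; right; exists (choice.pickle v) => //.
  by rewrite /F choice.pickleK /= => -[].
have mUF : measurable (\bigcup_n F n) by exact: bigcupT_measurable.
by apply: (le_trans (measureU2 _ mB mUF)); rewrite [X in (_ + X)%E]F0 adde0.
Qed.

Lemma eq_prob_regular (A B : set field) : measurable A -> measurable B ->
  (forall U, regular U -> A U <-> B U) -> P A = P B.
Proof.
by move=> mA mB AB; apply/eqP; rewrite eq_le !le_prob_regular// => U /AB[].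
Qed.

End Law.

(** Steps leave such a set only towards negative times, so percolation from its points lives on a
    finite graph. *)
Definition closed_window (n : nat) (V : {fset site d}) : Prop :=
  (forall v, v \in V -> 0 <= v.2 <= n%:Z) /\
  (forall v z, v \in V -> X z -> 0 <= (v + z).2 -> v + z \in V).

Lemma closed_windowP n : exists2 V, closed_window n V & time n \in V.
Proof.
have finX : finite_set X by apply: sub_finite_set XR _; exact: finite_range_box.
(* The sites obtained from [time n] by exactly [k] steps lie at times at most [n - k], so [n] steps
   exhaust the nonnegative times. *)
pose gen k := iter k (fun A : {fset site d} =>
  [fset (a + z)%R | a in A, z in fset_set X]%fset) [fset time n]%fset.
have gen_le k v : v \in gen k -> v.2 <= n%:Z - k%:Z.
  elim: k v => [|k IH] v /=; first by move=> /fset1P ->; rewrite subr0.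
  move=> /imfset2P[a /= /IH ak [z /=]]; rewrite in_fset_set// inE => Xz ->.
  have lez (m m' : int) : m < m' -> m' <= n%:Z - k%:Z ->
      m <= n%:Z - k.+1%:Z by lia.
  exact: lez (range_box_lt a (XR Xz)) ak.
pose gens : seq (site d) :=
  flatten [seq (gen k : seq (site d)) | k <- iota 0 n.+1].
have gensP v : reflect (exists2 k, (k < n.+1)%N & v \in gen k) (v \in gens).
  by apply: (iffP flatten_mapP) => -[k]; rewrite ?mem_iota => kn vk; exists k;
    rewrite ?mem_iota.
exists [fset v in gens | 0 <= v.2]%fset; last first.
  rewrite !inE /=; apply/andP; split=> //.
  by apply/gensP; exists 0%N => //=; rewrite fset11.
split=> [v|v z]; rewrite !inE /=.
  move=> /andP[/gensP[k _ /gen_le vk] ->] /=; apply: (le_trans vk).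
  by rewrite lerBlDr lerDl.
move=> /andP[/gensP[k _ vk] v0] Xz vz0; rewrite vz0 andbT.
have kn : (k.+1 < n.+1)%N.
  have gez (m m' : int) : 0 <= m -> m < m' -> m' <= n%:Z - k%:Z ->
      (k.+1 < n.+1)%N.
    by lia.
  exact: gez vz0 (range_box_lt v (XR Xz)) (gen_le _ _ vk).
apply/gensP; exists k.+1 => //=.
by apply/imfset2P; exists v => //; exists z => //; rewrite in_fset_set ?inE.
Qed.

(** * The finite graph of a closed window *)

Section Graph.
Variables (n : nat) (V : {fset site d}).
Hypothesis Vc : closed_window n V.

Definition edge : rel V := fun u v : V => `[< X (val v - val u) >].

Definition exit : pred V := fun u : V =>
  `[< exists2 z, X z & (val u + z).2 < 0 >].

(** A step from a point of the window either stays in it, where induction on time applies, or lands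
    at a negative time, where the initial state is 1. *)
Lemma eta_crosses U (v : fset_sub_type V) : regular U ->
  eta U (config1 r) (val v) = crosses edge exit v (window val U).
Proof.
move=> rU; have [Vn Vs] := Vc.
have V0 x : x \in V -> 0 <= x.2 by move=> /Vn/andP[].
have [k] : exists k : nat, (val v).2 < k%:Z by exists (absz (val v).2).+1; lia.
elim: k v => [|k IH] v vk; first by have := V0 _ (valP v); rewrite leNgt vk.
apply/idP/idP.
  move=> /(eta_regular _ rU (V0 _ (valP v)))[ov [z Xz ez]].
  rewrite /crosses ffunE ov /=.
  have [vz0|vz0] := ltP (val v + z).2 0.
    by apply: exits_exit; apply/asboolP; exists z.
  pose y : V := [` Vs _ _ (valP v) Xz vz0]%fset.
  have yk : (val y).2 < k%:Z.
    exact: ltz_pred (range_box_lt _ (XR Xz)) vk.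
  have := ez; rewrite -[v' in eta _ _ v']/(val y) IH// => /andP[oy ey].
  by apply: exits_arc oy ey; apply/asboolP; rewrite /= addrC addKr.
rewrite /crosses ffunE => /andP[ov]; rewrite inE => /existsP[y /andP[b_y]].
move=> /connectP[[|x q] /=].
  move=> _ yv; apply/(eta_regular _ rU (V0 _ (valP v))); split=> //.
  move: b_y; rewrite yv => /asboolP[z Xz vz]; exists z => //.
  have vs : (- r <= (val v + z).2%:~R) && ((val v + z).2 < 0).
    rewrite vz andbT -[X in X%:~R](addr0 (val v + z).2).
    by apply: (@range_boxD _ _ _ 0); [rewrite addr0;
      exact: V0 _ (valP v)|exact: XR].
  by rewrite (eta_slab _ _ vs).
move=> /andP[/andP[/asboolP vx]]; rewrite ffunE => ox xq yE.
apply/(eta_regular _ rU (V0 _ (valP v))); split=> //.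
exists (val x - val v) => //; rewrite subrKC IH.
  rewrite /crosses ffunE ox /= inE; apply/existsP; exists y; rewrite b_y /=.
  by apply/connectP; exists q.
by apply: ltz_pred vk; have := range_box_lt (val v) (XR vx); rewrite subrKC.
Qed.

Lemma prob_eta (P : probability field K) (v : V) : iid_law (gosp r X p) P ->
  P [set U | eta U (config1 r) (val v)] =
  (prob p%:num (crosses edge exit v))%:E.
Proof.
move=> uP; rewrite -(prob_window val_inj (crosses edge exit v) uP).
apply: (eq_prob_regular uP).
- exact: measurable_eta_init.
- exact: measurable_window val_inj _.
- by move=> U rU /=; rewrite eta_crosses.
Qed.

Lemma edge_indegree (v : V) : (#|[pred u | edge u v]| <= #|` fset_set X|)%N.
Proof.
have finX : finite_set X by apply: sub_finite_set XR _; exact: finite_range_box.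
rewrite cardE -(size_map (fun u : V => val v - val u)); apply: uniq_leq_size.
  rewrite map_inj_uniq ?enum_uniq// => u w /addrI/oppr_inj; exact: val_inj.
move=> z /mapP[u]; rewrite mem_enum inE => /asboolP Xz ->.
by rewrite in_fset_set//; exact: mem_set.
Qed.

End Graph.

End Percolation.

(** * Exponential decay *)

Lemma absz_between (k n : nat) (m m' : int) :
  m < m' -> m' <= n%:Z -> k%:Z <= m -> (k <= absz m < n)%N.
Proof. by case: m => // m; rewrite lez_nat => mm' /(lt_le_trans mm') + ->. Qed.

Section Decay.
Context {K : realType} {d : nat} {r : K}.
Local Notation field := (field d r).
Local Notation eta := Defs.eta.
Variables (X : set (site d)).
Hypothesis r1 : 1 <= r.
Hypothesis XR : X `<=` range_box r.
Hypothesis X0 : X !=set0.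
Implicit Types (U : field) (v z a : site d) (p : {i01 K}).

(** If every outflow at [p] were at least 1, [prob_crosses_ge] would bound the survival probability
    at [p'] below, uniformly in [n], against [eta_extinction]. *)
Lemma exists_outflow_lt1 p p' (P : probability field K) : p%:num < p'%:num ->
  iid_law (gosp r X p') P -> unique_invariant0 (gosp r X p') ->
  exists n (V : {fset site d}) (o : V) (S : {set V}),
    [/\ closed_window X n V, val o = time n, o \in S,
        forall x, x \in S -> ~~ exit X x &
        outflow (@edge _ X V) p%:num S o < 1].
Proof.
move=> pp' uP uniq.
have finX : finite_set X by apply: sub_finite_set XR _; exact: finite_range_box.
pose D := #|` fset_set X|.
have D0 : (0 < D)%N.
  rewrite cardfs_gt0; apply/fset0Pn; case: X0 => x Xx; exists x.
  by rewrite in_fset_set//; exact: mem_set.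
(* This threshold is the lower bound that [prob_crosses_ge] would give. *)
have e0 : 0 < (p'%:num - p%:num) / D%:R.
  by rewrite divr_gt0 ?ltr0n// subr_gt0.
have [n] := eta_extinction r1 e0 uniq uP.
have [V Vc nV] := closed_windowP XR n.
rewrite -[time n]/(val [` nV]%fset); set o : V := [` nV]%fset.
rewrite (prob_eta XR X0 Vc o uP) lte_fin ltr_pdivlMr ?ltr0n// mulrC => lt.
exists n, V, o; apply: contrapT => noS.
move: lt; apply/negP; rewrite -leNgt.
apply: (@prob_crosses_ge _ _ _ _ p%:num) => //.
- by move=> v; have := edge_indegree XR v.
- move=> S oS Sb; rewrite leNgt; apply/negP => out; apply: noS; exists S.
  by split.
Qed.

Section Step.
Variables (p : {i01 K}) (P : probability field K).
Hypothesis uP : iid_law (gosp r X p) P.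
Variables (n0 : nat) (V0 : {fset site d}) (o : V0) (S : {set V0}).
Hypothesis V0c : closed_window X n0 V0.
Hypothesis o0 : val o = time n0.
Hypothesis oS : o \in S.
Hypothesis Sb : forall x, x \in S -> ~~ exit X x.

Let theta n : \bar K := P [set U | eta U (config1 r) (time n)].

(** The set [S] is moved by [n - n0] in time, so that it starts from [time n], and [prob_crosses_le]
    is applied there. The sites just outside lie at times from [n - n0] to [n - 1], and a
    translation in space reduces them to [theta]. *)
Lemma decay_step n (M : K) : (n0 <= n)%N -> 0 <= M ->
  (forall m, (n - n0 <= m < n)%N -> (theta m <= M%:E)%E) ->
  (theta n <= (outflow (@edge _ X V0) p%:num S o * M)%:E)%E.
Proof.
move=> n0n M0 thetaM.
have p01 : 0 <= p%:num <= 1 by apply/andP; split.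
have r0 : 0 <= r by apply: le_trans r1.
have [V Vc nV] := closed_windowP XR n.
pose o' : V := [` nV]%fset.
pose tm : site d := time (n - n0)%N.
have tmE : time n0 + tm = time n.
  by congr pair; [exact: addr0|by rewrite -[in RHS](subnKC n0n) PoszD].
(* The map [h] moves the large window back to [V0], with the junk value [o] off the translate of
   [V0]; the equation in [S'] discards the points where this default occurs. *)
pose h (w : V) : V0 := insubd o (val w - tm).
have hE (w : V) (w0 : V0) : val w0 + tm = val w -> h w = w0.
  by move=> ww0; apply: val_inj; rewrite /h -ww0 addrK val_insubd (valP w0).
pose S' : {set V} := finset (fun w => (h w \in S) && (val (h w) + tm == val w)).
have S'P w : reflect (h w \in S /\ val (h w) + tm = val w) (w \in S').
  by rewrite inE; apply: (iffP andP) => -[-> /eqP].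
have ho' : h o' = o by apply: hE; rewrite o0.
have o'S' : o' \in S' by apply/S'P; rewrite ho' o0.
have nexit (u : V) z : u \in S' -> X z -> 0 <= (val (h u) + z).2.
  move=> /S'P[/Sb /asboolPn hu _] Xz; rewrite leNgt; apply/negP => uz.
  by apply: hu; exists z.
have S'b u : u \in S' -> ~~ exit X u.
  move=> uS; apply/asboolPn => -[z Xz].
  have [_ <-] := S'P _ uS; rewrite addrAC ltNge => /negP; apply.
  by rewrite addr_ge0 ?nexit.
(* Points of [S] have no step to a negative time, so a step out of [S'] moves back to a step that
   stays in [V0] and leaves [S]. *)
have crossing (u v : V) : u \in S' -> v \notin S' -> edge X u v ->
    [/\ h v \notin S, edge X (h u) (h v), val (h v) + tm = val v &
        (n - n0 <= absz (val v).2 < n)%N].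
  move=> uS vS /asboolP Xz; have [hu uE] := S'P _ uS.
  have uz := nexit _ _ uS Xz.
  have [V0n V0s] := V0c.
  have vV0 : val (h u) + (val v - val u) \in V0 by exact: V0s (valP _) Xz uz.
  have vE : val (h u) + (val v - val u) + tm = val v by rewrite addrAC uE
      subrKC.
  have hv : val (h v) = val (h u) + (val v - val u).
    by rewrite (hE v [` vV0]%fset).
  have hvE : val (h v) + tm = val v by rewrite hv.
  split=> //.
  - by apply: contraNN vS => hvS; apply/S'P.
  - by apply/asboolP; rewrite /= hv addrC addKr.
  - have [Vn _] := Vc; have /andP[_ un] := Vn _ (valP u).
    have vu : (val v).2 < (val u).2.
      by have := range_box_lt (val u) (XR Xz); rewrite subrKC.
    have lev : (n - n0)%N%:Z <= (val v).2.
      by rewrite -hvE; have := uz; rewrite -hv => hv0; rewrite -[leLHS]add0r;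
        exact: lerD.
    exact: absz_between vu un lev.
(* Both probabilities are realised on the same field, seen through [V] and through [V0] moved by
   [tm], so an inclusion of events suffices. *)
have reach_le (u : V) : u \in S' ->
    prob p%:num (reach (@edge _ X V) S' o' u) <=
    prob p%:num (reach (@edge _ X V0) S o (h u)).
  move=> uS; rewrite -lee_fin.
  have inj_j : injective (fun w : V0 => val w + tm) by move=> w w' /addIr;
      exact: val_inj.
  rewrite -(prob_window XR X0 val_inj _ uP) -(prob_window XR X0 inj_j _ uP).
  apply: le_measure; rewrite ?inE;
    [exact: measurable_window val_inj _|exact: measurable_window inj_j _|].
  move=> U /=; apply: (@reach_ind _ _ _ _ _ _ (fun u =>
    reach (@edge _ X V0) S o (h u) _)).
    move=> oo _; rewrite ho'; apply: reach_refl => //.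
    by move: oo; rewrite !ffunE o0 tmE.
  move=> x y ox; have xS := reach_sub ox.
  move=> hx /asboolP xy oy /S'P[hyS yE]; apply: (reach_arc hx) => //.
    apply/asboolP; have [_ xE] := S'P _ xS.
    by move: xy; rewrite /= -yE -xE opprD addrACA subrr addr0.
  by move: oy; rewrite !ffunE yE.
rewrite /theta -[time n]/(val o') (prob_eta XR X0 Vc o' uP) lee_fin.
apply: (le_trans (prob_crosses_le _ o'S' S'b p01)).
have cross_le (u v : V) : u \in S' -> v \notin S' -> edge X u v ->
    prob p%:num (crosses (@edge _ X V) (@exit _ X V) v) <= M.
  move=> uS vS uv; have [_ _ _ vn] := crossing _ _ uS vS uv.
  have [Vn _] := Vc; have /andP[v0 _] := Vn _ (valP v).
  rewrite -lee_fin -(prob_eta XR X0 Vc v uP) (prob_eta_space uP)//.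
  exact: thetaM.
rewrite /outflow mulr_suml.
pose F (w : V0) := (\sum_(v | (v \notin S) && edge X w v)
   prob p%:num (reach (@edge _ X V0) S o w)) * M.
apply: (@le_trans _ _ (\sum_(u in S') F (h u))); last first.
  apply: (ler_sum_inj (G := F)).
  - by move=> u w /S'P[_ uE] /S'P[_ wE] uw; apply: val_inj;
      rewrite /= -uE -wE uw.
  - by move=> u /S'P[].
  - by move=> w; rewrite mulr_ge0// sumr_ge0// => v _; exact: prob_ge0.
apply: ler_sum => u uS; rewrite /F mulr_suml.
apply: (@le_trans _ _ (\sum_(v | (v \notin S') && edge X u v)
    (prob p%:num (reach (@edge _ X V0) S o (h u)) * M))).
  apply: ler_sum => v /andP[vS uv].
  by rewrite ler_pM ?prob_ge0// ?reach_le// (cross_le u).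
apply: (@ler_sum_inj _ _ _ _ _ h (fun=> prob p%:num (reach (@edge _ X V0) S o
  (h u)) * M)).
- move=> v w /andP[vS uv] /andP[wS uw] vw; apply: val_inj.
  have [_ _ <- _] := crossing _ _ uS vS uv;
      have [_ _ <- _] := crossing _ _ uS wS uw.
  by rewrite vw.
- by move=> v /andP[vS uv]; have [-> ->] := crossing _ _ uS vS uv.
- by move=> _; rewrite mulr_ge0 ?prob_ge0.
Qed.

(** Each application of [decay_step] gains a factor [phi] and goes back in time by at most [n0]. The
    block length [n0.+1] is positive even when [n0] is 0. *)
Lemma decay n : outflow (@edge _ X V0) p%:num S o <= 1 ->
  (theta n <= (outflow (@edge _ X V0) p%:num S o ^+ (n %/ n0.+1))%:E)%E.
Proof.
set phi := outflow _ _ _ _ => phi1.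
have p01 : 0 <= p%:num <= 1 by apply/andP; split.
have phi0 : 0 <= phi.
  by apply: sumr_ge0 => u _; apply: sumr_ge0 => v _; exact: prob_ge0.
elim/ltn_ind: n => n IH; have [nn0|n0n] := ltnP n n0.+1.
  by rewrite divn_small// expr0;
    exact: probability_le1 (measurable_eta_init _ _).
have -> : (n %/ n0.+1 = ((n - n0.+1) %/ n0.+1).+1)%N.
  by rewrite -{1}(subnK n0n) -{2}[n0.+1]mul1n divnDMl// addn1.
rewrite exprS; apply: decay_step; rewrite ?exprn_ge0//; first exact: ltnW.
move=> m /andP[nm mn]; apply: (le_trans (IH _ mn)); rewrite lee_fin.
by apply: ler_wiXn2l => //; apply: leq_div2r; lia.
Qed.

End Step.
End Decay.

(** * The exponential rate below the critical density *)

Section ExponentialDecay.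
Context {K : realType} {d : nat} {r : K}.
Local Notation field := (field d r).
Local Notation eta := Defs.eta.
Local Notation upset := Defs.upset.
Variables (X : set (site d)) (p : {i01 K}).
Hypothesis r1 : 1 <= r.
Hypothesis XR : X `<=` range_box r.
Implicit Types (U : field) (v z a : site d).

Lemma unique_below_crit (p' : {i01 K}) :
  p'%:num < p_crit r X -> unique_invariant0 (gosp r X p').
Proof.
move=> p'c; apply: contrapT => bad.
have Bp' : gosp_bad r X p'%:num by exists p'.
move: p'c; apply/negP; rewrite -leNgt /p_crit asboolF; last first.
  by move=> B0; have : set0 p'%:num by rewrite -B0.
by apply: ge_inf => //; exists 0 => _ [q [<- _]].
Qed.

Lemma p_crit_le1 : p_crit r X <= 1.
Proof.
rewrite /p_crit; case: asboolP => // /eqP/set0P[x [q [_ bad]]].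
apply: (@le_trans _ _ q%:num) => //; apply: ge_inf; last by exists q.
by exists 0 => _ [q' [<- _]].
Qed.

Lemma eta_null (P : probability field K) n : X = set0 ->
  iid_law (gosp r X p) P -> P [set U | eta U (config1 r) (time n)] = 0%E.
Proof.
move=> X0 uP; apply/eqP; rewrite eq_le measure_ge0 andbT.
pose E : set (upfamily d r) := [set F | exists Y, upset F Y].
have -> : 0%E = P (rect [fset time n]%fset (fun=> E)).
  rewrite [RHS]uP big_seq_fset1 [RHS]gospE !memNset/= ?mulr0 ?addr0//.
    by move=> [].
  by move=> [Y [_ [z []]]]; rewrite X0.
apply: le_measure; rewrite ?inE;
  [exact: measurable_eta_init|exact: measurable_rect|].
by move=> U /=; rewrite eta_rec// => /asboolP UY v /fset1P ->; eexists;
  exact: UY.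
Qed.

(** Rounding the quotient down loses less than one factor [a], whence the constant [a^-1]. *)
Lemma exp_divn_le (a : K) (L n : nat) : 0 < a -> (0 < L)%N -> a < 1 ->
  a ^+ (n %/ L) <= a^-1 * expR (- (- ln a / L%:R) * n%:R).
Proof.
move=> a0 L0 a1; have aE : a = expR (ln a) by rewrite lnK.
have la : ln a < 0 by rewrite ln_lt0// a0.
have L0' : 0 < L%:R :> K by rewrite ltr0n.
rewrite {1 2}aE -expRN -expRM_natr -expRD ler_expR.
have : n%:R / L%:R <= (n %/ L)%:R + 1 :> K.
  rewrite ler_pdivrMr// natr1 -natrM ler_nat; apply: ltnW; exact: ltn_ceil.
move=> /(ler_wnM2l (ltW la)).
have -> : - (- ln a / L%:R) * n%:R = ln a * (n%:R / L%:R).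
  by field; rewrite gt_eqF.
by rewrite mulrDr mulr1; lra.
Qed.

Lemma eta_decay (P : probability field K) : p%:num < p_crit r X ->
  iid_law (gosp r X p) P ->
  exists c C : K, [/\ 0 < c, 0 < C & forall n,
    (P [set U | eta U (config1 r) (time n)] <= (C * expR (- c * n%:R))%:E)%E].
Proof.
move=> pc uP.
have [X0|/eqP/set0P X0] := pselect (X = set0).
  exists 1, 1; split=> // n; rewrite (eta_null _ X0 uP) lee_fin mul1r.
  exact: expR_ge0.
(* The midpoint leaves room above [p] for the derivative argument and stays below [p_crit], where
   uniqueness holds. *)
pose q := (p%:num + p_crit r X) / 2.
have c1 := p_crit_le1.
have p0 : 0 <= p%:num by [].
have q0 : 0 <= q by rewrite /q; lra.
have q1 : q <= 1 by rewrite /q; lra.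
pose p' : {i01 K} := Itv01 q0 q1.
have uniq : unique_invariant0 (gosp r X p').
  by apply: unique_below_crit; rewrite /= /q; lra.
(* The given [P] has density [p], so a field of density [p'] has to be obtained from uniqueness. *)
have [P' uP'] := exists_iid_law r1 uniq.
have [|n0 [V [v0 [S [Vc v00 v0S Sb out]]]]] :=
    exists_outflow_lt1 r1 XR X0 (p := p) (p' := p') _ uP' uniq.
  by rewrite /= /q; lra.
set phi := outflow _ _ _ _ in out.
(* The outflow may vanish, and the logarithm needs a positive base. *)
pose a := Num.max phi (1/2).
have a0 : 0 < a by rewrite /a lt_max; apply/orP; right; lra.
have a1 : a < 1 by rewrite /a gt_max out /=; lra.
exists (- ln a / n0.+1%:R), a^-1; split; rewrite ?invr_gt0//.
  by rewrite divr_gt0// oppr_gt0 ln_lt0// a0.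
move=> n; apply: (le_trans (decay r1 XR X0 uP Vc v00 v0S Sb n (ltW out))).
rewrite lee_fin; apply: (le_trans _ (exp_divn_le _ a0 _ a1)) => //.
apply: lerXn2r; rewrite ?nnegrE ?(ltW a0)//.
  apply: sumr_ge0 => u _; apply: sumr_ge0 => v _; apply: prob_ge0.
  by apply/andP; split.
by rewrite /a le_max lexx.
Qed.

Lemma slab_ge (x : slab d r) : - (`|Num.ceil r|%N)%:Z <= (val x).2.
Proof.
have r0 : 0 <= r by apply: le_trans r1.
have /andP[rx x0] := valP x.
have [] // : [/\ forall i, `|((0 : 'rV[int]_d),
    (val x).2).1 0 i| <= `|Num.ceil r|%N%:Z,
  - (`|Num.ceil r|%N)%:Z <= (val x).2 & (val x).2 < 0].
apply: (@range_box_le d _ r (0, (val x).2)); split; last by rewrite rx.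
by move=> i /=; rewrite mxE oppr_le0 r0.
Qed.

End ExponentialDecay.

(** * Union bounds over light cones *)

Lemma prob_bigcup_seq_le (K : realType) (dT : measure_display)
    (T : measurableType dT) (P : probability T K) (I : choiceType) (s : seq I)
    (F : I -> set T) (M : K) :
  (forall i, measurable (F i)) -> (forall i, i \in s -> (P (F i) <= M%:E)%E) ->
  (P (\bigcup_(i in [set` s]) F i) <= ((size s)%:R * M)%:E)%E.
Proof.
move=> mF; rewrite bigcup_seq; elim: s => [|i s IH] FM.
  by rewrite big_nil measure0 mul0r.
rewrite big_cons; apply: (le_trans (measureU2 _ _ _)) => //.
  exact: bigsetU_measurable.
rewrite /= -nat1r mulrDl mul1r EFinD; apply: leeD.
  by apply: FM; rewrite inE eqxx.
by apply: IH => j js; apply: FM; rewrite inE js orbT.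
Qed.

(** Half of the rate absorbs the polynomial: each of the [d] linear factors is at most a constant
    times [expR (e * t)], by [1 + x <= expR x]. *)
Lemma poly_exp_le (K : realType) (N d : nat) (c : K) : 0 < c -> (0 < d)%N ->
  exists2 B : K, 1 <= B & forall t : nat,
    (((N * (t + N)).*2.+1 ^ d)%N%:R * expR (- c * t%:R) <=
     B * expR (- (c / 2) * t%:R)).
Proof.
move=> c0 d0; pose e := c / (2 * d%:R).
have d0' : 0 < d%:R :> K by rewrite ltr0n.
have e0 : 0 < e by rewrite divr_gt0// mulr_gt0.
(* Chosen so that [b * (1 + e * t)] dominates [2 * N * (t + N) + 1]. *)
pose b : K := 2 * N%:R * N%:R + 1 + 2 * N%:R / e.
have N0 : 0 <= N%:R :> K by rewrite ler0n.
have b1 : 1 <= b.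
  have : 0 <= 2 * N%:R * N%:R :> K by rewrite !mulr_ge0.
  have : 0 <= 2 * N%:R / e by rewrite divr_ge0 ?mulr_ge0// ltW.
  rewrite /b; lra.
exists (b ^+ d) => [|t]; first exact: exprn_ege1.
have t0 : 0 <= t%:R :> K by rewrite ler0n.
have lin : (N * (t + N)).*2.+1%:R <= b * expR (e * t%:R).
  apply: (@le_trans _ _ (b * (1 + e * t%:R))); last first.
    by rewrite ler_wpM2l ?expR_ge1Dx// (le_trans _ b1).
  rewrite -natr1 -muln2 !natrM natrD /b.
  have -> : (2 * N%:R * N%:R + 1 + 2 * N%:R / e) * (1 + e * t%:R) =
    2 * N%:R * N%:R + 1 + 2 * N%:R * t%:R + (2 * N%:R / e +
      (2 * N%:R * N%:R + 1) * (e * t%:R)) by field; rewrite gt_eqF.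
  have : 0 <= 2 * N%:R / e by rewrite divr_ge0 ?mulr_ge0// ltW.
  have : 0 <= (2 * N%:R * N%:R + 1) * (e * t%:R).
    by rewrite mulr_ge0 ?mulr_ge0 ?addr_ge0 ?mulr_ge0// ltW.
  lra.
rewrite natrX; apply: (@le_trans _ _ ((b * expR (e * t%:R)) ^+ d * expR (- c *
  t%:R))).
  rewrite ler_wpM2r ?expR_ge0//; apply: lerXn2r => //; rewrite nnegrE ?ler0n//.
  by rewrite mulr_ge0 ?expR_ge0// (le_trans _ b1).
rewrite exprMn -expRM_natl -mulrA -expRD ler_wpM2l ?exprn_ge0 ?(le_trans _
  b1)//.
rewrite ler_expR /e le_eqVlt; apply/orP; left; apply/eqP; field.
by rewrite gt_eqF.
Qed.

Theorem corollary1p5 (K : realType) (d : nat) (r : K) (X : set (site d))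
  (p : {i01 K}) (P : probability (field d r) K) :
  (1 <= d)%N -> 1 <= r -> X `<=` range_box r ->
  p%:num < p_crit r X ->
  iid_law (gosp r X p) P ->
  exists c C : K, [/\ 0 < c, 0 < C &
    forall (t : nat) (A : {fset slab d r}), (0 < t)%N ->
      (P [set U | eta_at U (config1 r) t 0%R <> false]
         <= (C * expR (- c * t%:R))%:E)%E /\
      (P [set U | eta_at U (config_of A) t <> (fun=> false)]
         <= (C * (#|` A|)%:R * expR (- c * t%:R))%:E)%E].
Proof.
move=> d1 r1 XR pc uP.
have r0 : 0 <= r by apply: le_trans r1.
have [c [C [c0 C0 decayP]]] := eta_decay r1 XR pc uP.
pose N := `|Num.ceil r|%N.
have [B B1 polyB] := poly_exp_le N c0 d1.
(* The halved rate pays for the number of sites in a light cone; the same constants serve the first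
   bound because the count is at least 1. *)
exists (c / 2), (C * B); split; first by rewrite divr_gt0.
  by rewrite mulr_gt0// (lt_le_trans _ B1).
(* The points of [A] lie at times at least [- N], so a path up to time [t] spans at most [t + N]
   units of time, at speed at most [N]. *)
move=> t A t0; pose R := (N * (t + N))%N.
have stateE w x : [set U : field d r | eta_at U w t x <> false] =
    [set U | Defs.eta U w (x, t%:Z)].
  by apply/seteqP; split=> U; rewrite /= /eta_at;
    case: (Defs.eta U w (x, t%:Z)).
split.
  rewrite stateE; apply: (le_trans (decayP t));
    rewrite lee_fin -mulrA ler_wpM2l ?(ltW C0)//.
  apply: le_trans (polyB t); rewrite ler_peMl ?expR_ge0// ler1n.
  by rewrite expn_gt0.
have aliveP (U : field d r) : eta_at U (config_of A) t <> (fun=> false) <->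
    exists x, Defs.eta U (config_of A) (x, t%:Z).
  split=> [ne|[x ex] /(congr1 (@^~ x))]; last by rewrite /eta_at ex.
  apply: contrapT => h; apply: ne; apply/funext => x; apply/negbTE/negP => ex.
  by apply: h; exists x.
pose F (a : slab d r) := \bigcup_(x in [set` box (val a).1 R])
  [set U : field d r | Defs.eta U (config1 r) (x, t%:Z)].
have mF a : measurable (F a).
  by apply: fin_bigcup_measurable => [|x _];
    [exact: finite_fset|exact: measurable_eta_init].
have PF a : (P (F a) <= (((R.*2.+1 ^ d)%N)%:R * (C * expR (- c * t%:R)))%:E)%E.
  have M0 : 0 <= C * expR (- c * t%:R) by rewrite mulr_ge0 ?expR_ge0// ltW.
  apply: (@le_trans _ _ ((#|` box (val a).1 R|)%:R * (C * expR (- c *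
    t%:R)))%:E).
    apply: prob_bigcup_seq_le => [x|x _]; first exact: measurable_eta_init.
    by rewrite (prob_eta_space uP)//; exact: decayP.
  by rewrite lee_fin ler_wpM2r// ler_nat; exact: card_box.
(* A site alive from [A] is alive from [config1] and lies in the light cone of some point of [A]. *)
apply: (@le_trans _ _ (P (\bigcup_(a in [set` A]) F a))).
  apply: (le_prob_regular uP).
  - rewrite [X in measurable X](_ : _ = \bigcup_x
      [set U : field d r | Defs.eta U (config_of A) (x, t%:Z)]).
      apply: countable_bigcupT_measurable; first exact: countableP.
      by move=> x; exact: measurable_eta_init.
    by apply/seteqP; split=> U /=; [move=> /aliveP[x ex];
      exists x|move=> [x _ ex]; apply/aliveP; exists x].
  - by apply: fin_bigcup_measurable => [|a _]; [exact: finite_fset|exact: mF].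
  - move=> U rU /= /aliveP[x ex].
    have [|e1 [a aA ax]] := eta_ancestor XR rU _ ex.
      by apply: (@le_trans _ _ 0); rewrite ?oppr_le0// ler0z.
    exists a => //; exists x => //=; apply: in_box => i.
    apply: (le_trans (ax i)); rewrite /R PoszM; apply: ler_wpM2l => //=.
    by rewrite PoszD lerD2l lerNl; exact: slab_ge.
apply: (le_trans (prob_bigcup_seq_le mF (fun a _ => PF a))).
rewrite lee_fin; have := polyB t; rewrite -/R.
set x := expR (- c * t%:R); set y := expR _; set Q := (_ ^ _)%N%:R => QB.
have -> : (#|` A|)%:R * (Q * (C * x)) = (#|` A|)%:R * C * (Q * x) by ring.
have -> : C * B * (#|` A|)%:R * y = (#|` A|)%:R * C * (B * y) by ring.
by rewrite ler_wpM2l// mulr_ge0// ltW.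
Qed.
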